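(* The decision problem \textsc{Min-Max-Dec} (given an instance $(N,P,T,(\mathbf{D}_i)_{i\in N})$ and a set of constraints $\mathbf{A}$, decide whether there is an outcome $\mathbf{o}$ with $\max_{i\in N} d_i(\mathbf{o}^{(t)})\le\lambda$ for every $(t,\lambda)\in\mathbf{A}$) is in XP with respect to the number of agents $n$.
   Context: An instance is a tuple $(N,P,T,(\mathbf{D}_i)_{i\in N})$ with agents $N=[n]$, projects $P=\{p_1,\dots,p_m\}$, timesteps $T=[\ell]$, and for each agent $i$ and timestep $k$ a disapproval set $D_{ik}\subseteq P$. An outcome is $\mathbf{o}=(o_1,\dots,o_\ell)$ with $o_k\in P$; $\mathbf{o}^{(k)}=(o_1,\dots,o_k)$, and $d_i(\mathbf{o}^{(k)})=|\{t\in[k]: o_t\in D_{it}\}|$. A set of constraints is $\mathbf{A}=\{(t_1,\lambda_1),\dots,(t_\tau,\lambda_\tau)\}$ with $t_j\in T$, $\lambda_j\in\{0,\dots,\ell\}$, $t_1\le\dots\le t_\tau$, $\lambda_1\le\dots\le\lambda_\tau$. *)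

(* Defs.v *)
From mathcomp Require Import all_boot.
Set Implicit Arguments. Unset Strict Implicit. Unset Printing Implicit Defensive.

(* Agents N = {0..n-1}, projects P = {p_1..p_m} as 'I_m, timesteps       *)
(* T = [l] represented 0-indexed by 'I_l (timestep k+1 <-> index k).    *)
Record instance := Instance {
  n_agents : nat;
  m_projects : nat;
  l_steps : nat;
  disapp : 'I_n_agents -> 'I_l_steps -> {set 'I_m_projects}
}.

Definition outcome (I : instance) := 'I_(l_steps I) -> 'I_(m_projects I).

(* d_i(o^(t)) = |{ k in [t] : o_k in D_ik }| (1-indexed timesteps t) *)
Definition disagree (I : instance) (o : outcome I) (i : 'I_(n_agents I)) (t : nat) : nat :=
  #|[set k : 'I_(l_steps I) | (k < t) && (o k \in disapp i k)]|.

Definition valid_constraints (I : instance) (A : seq (nat * nat)) : bool :=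
  all (fun c => (1 <= c.1 <= l_steps I) && (c.2 <= l_steps I)) A
  && sorted leq (map fst A) && sorted leq (map snd A).

Definition minmax_yes (I : instance) (A : seq (nat * nat)) : Prop :=
  exists o : outcome I,
    forall c, c \in A -> \max_(i < n_agents I) disagree o i c.1 <= c.2.

Definition encode (I : instance) (A : seq (nat * nat)) : seq nat :=
  [:: n_agents I; m_projects I; l_steps I]
  ++ flatten [seq flatten [seq (#|disapp i k| :: [seq val p | p <- enum (disapp i k)])
                          | k <- enum 'I_(l_steps I)]
             | i <- enum 'I_(n_agents I)]
  ++ (size A :: flatten [seq [:: c.1; c.2] | c <- A]).

(* Input size: unary size of the encoding (all numbers occurring are
   bounded by n, m or l, which are part of the input). *)
Definition input_size (x : seq nat) : nat := sumn [seq y.+1 | y <- x].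

Inductive instr :=
| IConst of nat & nat
| IAdd of nat & nat & nat
| ISub of nat & nat & nat
| ILoad of nat & nat
| IStore of nat & nat
| IJz of nat & nat
| IJmp of nat
| IHalt.

Definition program := seq instr.

Record ram_state := RamState { pc : nat; mem : nat -> nat }.

Definition upd (f : nat -> nat) (a v : nat) : nat -> nat :=
  fun j => if j == a then v else f j.

(* One step; None when the machine has halted (IHalt or pc out of range). *)
Definition step (p : program) (s : ram_state) : option ram_state :=
  let R := mem s in
  let nx := (pc s).+1 in
  match nth IHalt p (pc s) with
  | IConst r c => Some (RamState nx (upd R r c))
  | IAdd r a b => Some (RamState nx (upd R r (R a + R b)))
  | ISub r a b => Some (RamState nx (upd R r (R a - R b)))
  | ILoad r a => Some (RamState nx (upd R r (R (R a))))
  | IStore a b => Some (RamState nx (upd R (R a) (R b)))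
  | IJz a j => Some (RamState (if R a == 0 then j else nx) R)
  | IJmp j => Some (RamState j R)
  | IHalt => None
  end.

Fixpoint exec (p : program) (k : nat) (s : ram_state) : ram_state :=
  match k with
  | 0 => s
  | k'.+1 => match step p s with Some s' => exec p k' s' | None => s end
  end.

Definition init_state (x : seq nat) : ram_state :=
  RamState 0 (fun j => if j is j'.+1 then nth 0 x j' else size x).

Definition halts_within (p : program) (x : seq nat) (t y : nat) : Prop :=
  let s := exec p t (init_state x) in step p s = None /\ mem s 0 = y.

Definition ram_computable (f : nat -> nat) : Prop :=
  exists q : program, forall k, exists t, halts_within q [:: k] t (f k).

Definition minmax_dec_in_XP_n : Prop :=
  exists (p : program) (f : nat -> nat),
    ram_computable f /\
    forall (I : instance) (A : seq (nat * nat)),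
      valid_constraints I A ->
      let x := encode I A in
      exists y : nat,
        halts_within p x (f (n_agents I) * (input_size x) ^ f (n_agents I)) y
        /\ y <= 1 /\ (y = 1 <-> minmax_yes I A).

(* Main.v *)
Require Import Defs.
From mathcomp Require Import all_boot.
From mathcomp Require Import zify.
Set Implicit Arguments. Unset Strict Implicit. Unset Printing Implicit Defensive.

(* Dynamic programming over the vectors of disagreement counts.  With
   b = l + 1, the vector (d_1, ..., d_n) is stored as the base-b number
   \sum_i d_i b^i < b^n.  No count exceeds l, so choosing project p at step k
   is the carry-free addition of the constant \sum_(i | p \in D_ik) b^i, and
   the set of codes reachable after k steps without violating a constraint is
   computed layer by layer.  A constraint (t, lambda) excludes, at layer t, the
   codes whose largest digit exceeds lambda.  This takes O((S^(n+1))^3) steps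
   on inputs of size S.

   The algorithm is written in a language of bounded loops over registers and
   arrays, whose programs always terminate and hence have total semantics and
   cost functions, and is compiled to the RAM. *)

(** * Loop programs and their compilation *)

(** Constraints read only the counts, so admissible partial outcomes of equal length with the same
    count vector are interchangeable; there are at most [(l + 1) ^ n] vectors, polynomially many for
    fixed [n]. The obstacle is the machine: it has no multiplication or division, its only test is
    for zero, and its memory initially is the input. Hence products become indices advanced by
    additions, largest digits are tabulated rather than extracted, and maxima and comparisons are
    made from truncated subtraction. A carry out of the top digit would moreover write into the
    wrong layer of the table, so the bound [b ^ n] on all reachable codes is part of correctness.
    With [S] the input size, [S ^ n.+1] bounds the length of every loop, and loops nest at most
    three deep, whence the cube. *)

(* Registers 0, ..., 11 hold the program variables, register 12 the base address
   F >= 20 of the arrays, and registers 13, ..., 19 intermediate values.  Entry a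
   of array q < 8 lives at address F + 8 * a + q, so arrays never alias. *)
Notation base_reg := 12.
Notation tmp := 13.
Notation reg_bound := 20.

Inductive expr :=
| EConst of nat
| EVar of nat
| EAdd of expr & expr
| ESub of expr & expr
| EArr of nat & expr.

(* [For v w e c] runs [c] for v = 0, ..., e - 1, where [w] keeps the bound, so
   that [c] may change the data on which [e] depends. *)
Inductive cmd :=
| Asg of nat & expr
| Sto of nat & expr & expr
| Seq of cmd & cmd
| If of expr & cmd
| For of nat & nat & expr & cmd.

Record state := State { regs : nat -> nat; arr : nat -> nat -> nat }.

Definition setr (v x : nat) (s : state) : state :=
  State (upd (regs s) v x) (arr s).

Definition seta (q a x : nat) (s : state) : state :=
  State (regs s) (fun q' a' => if (q' == q) && (a' == a) then x else arr s q' a').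

Fixpoint eval (e : expr) (s : state) : nat :=
  match e with
  | EConst c => c
  | EVar v => regs s v
  | EAdd e1 e2 => eval e1 s + eval e2 s
  | ESub e1 e2 => eval e1 s - eval e2 s
  | EArr q e1 => arr s q (eval e1 s)
  end.

Definition incr (v : nat) (s : state) : state := setr v (regs s v).+1 s.

Fixpoint run (c : cmd) (s : state) : state :=
  match c with
  | Asg v e => setr v (eval e s) s
  | Sto q e1 e2 => seta q (eval e1 s) (eval e2 s) s
  | Seq c1 c2 => run c2 (run c1 s)
  | If e c1 => if eval e s == 0 then s else run c1 s
  | For v w e c1 =>
      iter (eval e s) (fun s' => incr v (run c1 s')) (setr v 0 (setr w (eval e s) s))
  end.

Definition comp_addr (q d : nat) : seq instr :=
  [:: IAdd d d d; IAdd d d d; IAdd d d d; IConst d.+1 q; IAdd d d d.+1; IAdd d d base_reg].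

(** Registers from [d] upwards form an evaluation stack, with the result left in [d]. As the machine
    cannot copy a register, a variable is added to a zero. *)
Fixpoint comp_expr (e : expr) (d : nat) : seq instr :=
  match e with
  | EConst c => [:: IConst d c]
  | EVar v => [:: IConst d 0; IAdd d v d]
  | EAdd e1 e2 => comp_expr e1 d ++ comp_expr e2 d.+1 ++ [:: IAdd d d d.+1]
  | ESub e1 e2 => comp_expr e1 d ++ comp_expr e2 d.+1 ++ [:: ISub d d d.+1]
  | EArr q e1 => comp_expr e1 d ++ comp_addr q d ++ [:: ILoad d d]
  end.

(** Jump targets are absolute, so the address [off] of the block is a parameter. In a loop [v] never
    exceeds [w], hence the truncated difference vanishes exactly when the rounds are used up. *)
Fixpoint compile (off : nat) (c : cmd) : seq instr :=
  match c with
  | Asg v e => comp_expr e tmp ++ [:: IConst tmp.+1 0; IAdd v tmp tmp.+1]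
  | Sto q e1 e2 =>
      comp_expr e1 tmp ++ comp_addr q tmp ++ comp_expr e2 tmp.+1 ++ [:: IStore tmp tmp.+1]
  | Seq c1 c2 => let p1 := compile off c1 in p1 ++ compile (off + size p1) c2
  | If e c1 =>
      let pe := comp_expr e tmp in
      let p1 := compile (off + size pe).+1 c1 in
      pe ++ [:: IJz tmp ((off + size pe).+1 + size p1)] ++ p1
  | For v w e c1 =>
      let pe := comp_expr e tmp in
      let top := (off + size pe).+3 in
      let p1 := compile top.+2 c1 in
      pe ++ [:: IConst tmp.+1 0; IAdd w tmp tmp.+1; IConst v 0]
         ++ [:: ISub tmp w v; IJz tmp ((top.+2 + size p1).+3)]
         ++ p1 ++ [:: IConst tmp 1; IAdd v v tmp; IJmp top]
  end.

(** This is the exact number of machine steps, as [comp_correct] shows. Besides the bound and the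
    body, a loop takes 3 steps to initialise, 2 + 3 per round for test and increment, and 2 for the
    last test. *)
Fixpoint cost (c : cmd) (s : state) : nat :=
  match c with
  | Asg v e => size (comp_expr e tmp) + 2
  | Sto q e1 e2 => size (comp_expr e1 tmp) + (6 + (size (comp_expr e2 tmp.+1) + 1))
  | Seq c1 c2 => cost c1 s + cost c2 (run c1 s)
  | If e c1 => size (comp_expr e tmp) + (1 + if eval e s == 0 then 0 else cost c1 s)
  | For v w e c1 =>
      size (comp_expr e tmp) + (3 +
      (\sum_(j < eval e s) (2 + (cost c1 (iter j (fun s' => incr v (run c1 s'))
                              (setr v 0 (setr w (eval e s) s))) + 3)) + 2))
  end.

Fixpoint writes (c : cmd) : seq nat :=
  match c with
  | Asg v _ => [:: v]
  | Sto _ _ _ => [::]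
  | Seq c1 c2 => writes c1 ++ writes c2
  | If _ c1 => writes c1
  | For v w _ c1 => v :: w :: writes c1
  end.

Fixpoint awrites (c : cmd) : seq nat :=
  match c with
  | Asg _ _ => [::]
  | Sto q _ _ => [:: q]
  | Seq c1 c2 => awrites c1 ++ awrites c2
  | If _ c1 => awrites c1
  | For _ _ _ c1 => awrites c1
  end.

(** Bounding the stack height keeps all temporaries below [reg_bound], away from the array cells. *)
Fixpoint wf_expr (e : expr) (d : nat) : bool :=
  match e with
  | EConst _ => d < reg_bound
  | EVar v => (v < base_reg) && (d < reg_bound)
  | EAdd e1 e2 | ESub e1 e2 => wf_expr e1 d && wf_expr e2 d.+1
  | EArr q e1 => [&& wf_expr e1 d, q < 8 & d.+1 < reg_bound]
  end.

(** The machine rereads [v] and [w] in every round; protecting both from the body forces the number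
    of rounds that [run] fixes in advance. *)
Fixpoint wf (c : cmd) : bool :=
  match c with
  | Asg v e => (v < base_reg) && wf_expr e tmp
  | Sto q e1 e2 => [&& q < 8, wf_expr e1 tmp & wf_expr e2 tmp.+1]
  | Seq c1 c2 => wf c1 && wf c2
  | If e c1 => wf_expr e tmp && wf c1
  | For v w e c1 =>
      [&& v < base_reg, w < base_reg, v != w, v \notin writes c1, w \notin writes c1,
          wf_expr e tmp & wf c1]
  end.

(** * Frame conditions and an invariant rule for loops *)

Lemma updE (f : nat -> nat) a v j : upd f a v j = if j == a then v else f j.
Proof. by []. Qed.

Definition frame (c : cmd) (s s' : state) : Prop :=
  (forall r, r \notin writes c -> regs s' r = regs s r) /\
  (forall q, q \notin awrites c -> arr s' q =1 arr s q).

Lemma run_frame c s : frame c s (run c s).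
Proof.
elim: c s => [v e|q e1 e2|c1 IH1 c2 IH2|e c IH|v w e c IH] s; split=> r /=.
- by rewrite inE updE => /negPf->.
- by [].
- by [].
- by rewrite inE => /negPf-> a.
- rewrite mem_cat negb_or => /andP[h1 h2].
  by rewrite (proj1 (IH2 _)) // (proj1 (IH1 _)).
- rewrite mem_cat negb_or => /andP[h1 h2] a.
  by rewrite (proj2 (IH2 _)) // (proj2 (IH1 _)).
- by case: ifP => // _; apply: (proj1 (IH _)).
- by case: ifP => // _; apply: (proj2 (IH _)).
- rewrite !inE !negb_or => /and3P[/negPf hv /negPf hw h].
  elim: {1}(eval e s) => [|j IHj] /=; first by rewrite !updE hv hw.
  by rewrite !updE hv (proj1 (IH _)) // IHj.
- move=> h a; elim: {1}(eval e s) => [|j IHj] //=.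
  by rewrite (proj2 (IH _)) // IHj.
Qed.

Lemma run_reg c s r : r \notin writes c -> regs (run c s) r = regs s r.
Proof. exact: (proj1 (run_frame c s)). Qed.

Lemma run_arr c s q a : q \notin awrites c -> arr (run c s) q a = arr s q a.
Proof. by move=> h; apply: (proj2 (run_frame c s)). Qed.

(** The body may assume the frame, so an invariant [I] need only mention what the loop changes. Cost
    is bounded along with the invariant because the cost of a round depends on the state in which it
    starts. *)
Lemma for_rule (I : nat -> state -> Prop) v w e c s B t :
  eval e s <= B ->
  v \notin writes c -> v != w ->
  I 0 (setr v 0 (setr w (eval e s) s)) ->
  (forall j s', j < eval e s -> frame (For v w e c) s s' -> regs s' v = j ->
     I j s' -> I j.+1 (setr v j.+1 (run c s')) /\ cost c s' <= t) ->
  I (eval e s) (run (For v w e c) s) /\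
  cost (For v w e c) s <= size (comp_expr e tmp) + 5 + B * (t + 5).
Proof.
move=> leB vc vw I0 IS /=.
set N := eval e s in leB I0 IS *; set s0 := setr v 0 _ in I0 *.
set f := fun s' => incr v (run c s').
have inv j : j <= N ->
  [/\ I j (iter j f s0), regs (iter j f s0) v = j & frame (For v w e c) s (iter j f s0)].
  elim: j => [|j IHj] lej.
    split=> //; first by rewrite /s0 /= updE eqxx.
    split=> // r; rewrite /s0 /= !updE !inE !negb_or => /and3P[/negPf-> /negPf-> _] //.
  have [Ij vj fj] := IHj (ltnW lej); have [IS1 _] := IS _ _ lej fj vj Ij.
  have rv : regs (run c (iter j f s0)) v = j by rewrite run_reg.
  have fE : f (iter j f s0) = setr v j.+1 (run c (iter j f s0)) by rewrite /f /incr rv.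
  rewrite iterS fE; split=> //; first by rewrite /= updE eqxx.
  case: fj => f1 f2; split=> [r hr|q hq a].
    have := hr; rewrite /= !updE !inE !negb_or => /and3P[/negPf-> _ h].
    by rewrite run_reg // f1.
  by rewrite /= run_arr ?f2.
split; first by case: (inv N).
have -> : size (comp_expr e tmp) + 5 + B * (t + 5)
   = size (comp_expr e tmp) + (3 + (B * (t + 5) + 2)) by lia.
rewrite !leq_add2l leq_add2r.
apply: (@leq_trans (\sum_(j < N) (t + 5))); last first.
  by rewrite sum_nat_const card_ord leq_mul2r leB orbT.
apply: leq_sum => j _; have [Ij vj fj] := inv j (ltnW (ltn_ord j)).
by have [_] := IS _ _ (ltn_ord j) fj vj Ij; lia.
Qed.

(** * Correctness of the compiler *)

Definition code_at (p : program) (off : nat) (c : seq instr) : Prop :=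
  forall j, j < size c -> nth IHalt p (off + j) = nth IHalt c j.

Lemma code_at_cat p off c1 c2 :
  code_at p off (c1 ++ c2) -> code_at p off c1 /\ code_at p (off + size c1) c2.
Proof.
move=> h; split=> j hj.
  by rewrite h ?size_cat ?nth_cat ?hj //; lia.
rewrite -addnA h ?size_cat ?ltn_add2l // nth_cat ifN ?addKn //; lia.
Qed.

Lemma code_at_cons p off i c :
  code_at p off (i :: c) -> nth IHalt p off = i /\ code_at p off.+1 c.
Proof.
move=> h; split; first by rewrite -[off]addn0 (h 0).
by move=> j hj; rewrite addSnnS (h j.+1).
Qed.

Lemma exec_add p t1 t2 s : exec p (t1 + t2) s = exec p t2 (exec p t1 s).
Proof.
elim: t1 s => // t IH s; rewrite addSn /=.
case E: (step p s) => [s'|]; first exact: IH.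
by case: t2 {IH} => //= t2; rewrite E.
Qed.

Lemma exec1 p off (mem : nat -> nat) i t s :
  nth IHalt p off = i ->
  match i with
  | IConst r c => Some (RamState off.+1 (upd mem r c))
  | IAdd r a b => Some (RamState off.+1 (upd mem r (mem a + mem b)))
  | ISub r a b => Some (RamState off.+1 (upd mem r (mem a - mem b)))
  | ILoad r a => Some (RamState off.+1 (upd mem r (mem (mem a))))
  | IStore a b => Some (RamState off.+1 (upd mem (mem a) (mem b)))
  | IJz a j => Some (RamState (if mem a == 0 then j else off.+1) mem)
  | IJmp j => Some (RamState j mem)
  | IHalt => None
  end = Some s ->
  exec p t.+1 (RamState off mem) = exec p t s.
Proof. by move=> h1 h2; rewrite /= /step /= h1 h2. Qed.

Definition rep (F : nat) (s : state) (mem : nat -> nat) : Prop :=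
  [/\ forall r, r < base_reg -> mem r = regs s r,
      mem base_reg = F &
      forall q a, q < 8 -> mem (F + 8 * a + q) = arr s q a].

Lemma rep_reg F s mem r : rep F s mem -> r < base_reg -> mem r = regs s r.
Proof. by case=> h _ _; exact: h. Qed.

Definition agree (d : nat) (mem mem' : nat -> nat) : Prop :=
  forall a, (a < d) || (reg_bound <= a) -> mem' a = mem a.

Lemma rep_agree F d s mem mem' :
  reg_bound <= F -> base_reg < d -> agree d mem mem' -> rep F s mem -> rep F s mem'.
Proof.
move=> leF ltd ag [r1 r2 r3]; split.
- by move=> r hr; rewrite ag ?r1 //; lia.
- by rewrite ag //; lia.
- by move=> q a hq; rewrite ag ?r3 //; lia.
Qed.

Lemma agree_trans d d' m1 m2 m3 :
  d <= d' -> agree d m1 m2 -> agree d' m2 m3 -> agree d m1 m3.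
Proof. by move=> le h1 h2 a ha; rewrite h2 ?h1 //; lia. Qed.

Lemma agree_upd d a v mem : d <= a < reg_bound -> agree d mem (upd mem a v).
Proof. by move=> h b hb; rewrite updE ifN //; lia. Qed.

Lemma wf_expr_lt e d : wf_expr e d -> d < reg_bound.
Proof.
elim: e d => //= [v|e1 IH1 e2 _|e1 IH1 e2 _|q e IH] d.
- by case/andP.
- by case/andP=> /IH1.
- by case/andP=> /IH1.
- by case/and3P=> /IH.
Qed.

Section Compiler.
Variables (p : program) (F : nat).
Hypothesis leF : reg_bound <= F.

Lemma rep_tmp s mem a v : tmp <= a < reg_bound -> rep F s mem -> rep F s (upd mem a v).
Proof. by move=> h; apply: (rep_agree (d := tmp)) => //; exact: agree_upd. Qed.

Definition reaches t off mem off' mem' :=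
  exec p t (RamState off mem) = RamState off' mem'.

Lemma reaches_trans t1 t2 o1 o2 o3 m1 m2 m3 :
  reaches t1 o1 m1 o2 m2 -> reaches t2 o2 m2 o3 m3 -> reaches (t1 + t2) o1 m1 o3 m3.
Proof. by rewrite /reaches => h1 h2; rewrite exec_add h1 h2. Qed.

Lemma reaches_cast t t' o1 o2 o2' m1 m2 :
  reaches t o1 m1 o2 m2 -> t' = t -> o2' = o2 -> reaches t' o1 m1 o2' m2.
Proof. by move=> h -> ->. Qed.

Lemma comp_addr_correct q d off mem :
  base_reg < d -> d.+1 < reg_bound -> mem base_reg = F ->
  code_at p off (comp_addr q d) ->
  exists mem', [/\ reaches 6 off mem (off + 6) mem',
    mem' d = F + 8 * mem d + q & agree d mem mem'].
Proof.
move=> hd hd2 hF.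
do 6! case/code_at_cons=> ?; move=> _.
eexists; split.
- rewrite /reaches; do 6! (erewrite exec1; [|eassumption|reflexivity]).
  by rewrite /= !addnS addn0.
- rewrite !updE !eqxx; rewrite ?ifN ?hF; lia.
- by move=> a ha; rewrite !updE !ifN //; lia.
Qed.

Lemma comp_expr_correct e d off s mem :
  base_reg < d -> wf_expr e d -> rep F s mem -> code_at p off (comp_expr e d) ->
  exists mem', [/\ reaches (size (comp_expr e d)) off mem (off + size (comp_expr e d)) mem',
    mem' d = eval e s & agree d mem mem'].
Proof.
elim: e d off mem => [c|v|e1 IH1 e2 IH2|e1 IH1 e2 IH2|q e IH] d off mem ltd /=.
- move=> hd hr /code_at_cons[h _]; eexists; split.
  + by rewrite /reaches; erewrite exec1; [|eassumption|reflexivity]; rewrite addn1.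
  + by rewrite updE eqxx.
  + by apply: agree_upd; lia.
- case/andP=> hv hd [r1 r2 r3] /code_at_cons[h /code_at_cons[h' _]]; eexists; split.
  + rewrite /reaches; do 2! (erewrite exec1; [|eassumption|reflexivity]).
    by rewrite addn2.
  + by rewrite !updE !eqxx ifN ?r1 ?addn0 //; lia.
  + by move=> a ha; rewrite !updE !ifN //; lia.
- case/andP=> w1 w2 hr /code_at_cat[/IH1 {}IH1 /code_at_cat[/IH2 {}IH2]].
  case/code_at_cons=> h _.
  have [m1 [x1 v1 a1]] := IH1 _ ltd w1 hr.
  have [m2 [x2 v2 a2]] := IH2 _ (ltnW ltd) w2 (rep_agree leF ltd a1 hr).
  have hd : d < reg_bound.
    exact: ltnW (wf_expr_lt w2).
  eexists; split.
  + rewrite size_cat; apply: reaches_trans x1 _; rewrite size_cat.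
    rewrite addnA; apply: reaches_trans x2 _.
    by rewrite /reaches [size _]/=; erewrite exec1; [|eassumption|reflexivity]; rewrite addnA addn1.
  + by rewrite updE eqxx v2 a2 ?v1 ?ltnSn.
  + apply: (agree_trans (leqnn d) a1); apply: (agree_trans (leqnn d) (m2 := m2)).
      by move=> a ha; apply: a2; lia.
    by apply: agree_upd; lia.
- case/andP=> w1 w2 hr /code_at_cat[/IH1 {}IH1 /code_at_cat[/IH2 {}IH2]].
  case/code_at_cons=> h _.
  have [m1 [x1 v1 a1]] := IH1 _ ltd w1 hr.
  have [m2 [x2 v2 a2]] := IH2 _ (ltnW ltd) w2 (rep_agree leF ltd a1 hr).
  have hd : d < reg_bound.
    exact: ltnW (wf_expr_lt w2).
  eexists; split.
  + rewrite size_cat; apply: reaches_trans x1 _; rewrite size_cat.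
    rewrite addnA; apply: reaches_trans x2 _.
    by rewrite /reaches [size _]/=; erewrite exec1; [|eassumption|reflexivity]; rewrite addnA addn1.
  + by rewrite updE eqxx v2 a2 ?v1 ?ltnSn.
  + apply: (agree_trans (leqnn d) a1); apply: (agree_trans (leqnn d) (m2 := m2)).
      by move=> a ha; apply: a2; lia.
    by apply: agree_upd; lia.
- case/and3P=> w1 hq hd hr /code_at_cat[/IH {}IH hcl].
  have [hc /code_at_cons[h _]] := @code_at_cat p _ (comp_addr q d) [:: ILoad d d] hcl.
  have [m1 [x1 v1 a1]] := IH _ ltd w1 hr.
  have hr1 := rep_agree leF ltd a1 hr.
  have [m2 [x2 v2 a2]] := comp_addr_correct ltd hd (let: And3 _ x _ := hr1 in x) hc.
  have [_ _ r3] := rep_agree leF ltd a2 hr1.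
  eexists; split.
  + rewrite size_cat [size (_ :: _)]/(6 + 1); apply: reaches_trans x1 _.
    rewrite addnA; apply: reaches_trans x2 _.
    by rewrite /reaches; erewrite exec1; [|eassumption|reflexivity]; rewrite -addnS.
  + by rewrite updE eqxx v2 v1 r3.
  + apply: (agree_trans (leqnn d) a1); apply: (agree_trans (leqnn d) a2).
    by apply: agree_upd; lia.
Qed.

Lemma rep_setr s mem v x :
  v < base_reg -> rep F s mem -> rep F (setr v x s) (upd mem v x).
Proof.
move=> hv [r1 r2 r3]; split=> [r hr||q a hq]; rewrite /= ?updE.
- by case: eqP => // _; exact: r1.
- by rewrite ifN //; lia.
- by rewrite ifN ?r3 //; lia.
Qed.

Lemma rep_seta s mem q a x :
  q < 8 -> rep F s mem -> rep F (seta q a x s) (upd mem (F + 8 * a + q) x).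
Proof.
move=> hv [r1 r2 r3]; split=> [r hr||q' a' hq]; rewrite /= ?updE.
- by rewrite ifN ?r1 //; lia.
- by rewrite ifN //; lia.
- rewrite -r3 //; have -> // : (F + 8 * a' + q' == F + 8 * a + q) = (q' == q) && (a' == a).
  lia.
Qed.

Lemma comp_correct c off s mem :
  wf c -> code_at p off (compile off c) -> rep F s mem ->
  exists2 mem', reaches (cost c s) off mem (off + size (compile off c)) mem' &
    rep F (run c s) mem'.
Proof.
elim: c off s mem => [v e|q e1 e2|c1 IH1 c2 IH2|e c IH|v w e c IH] off s mem /=.
- case/andP=> hv we /code_at_cat[he] /code_at_cons[h1] /code_at_cons[h2 _] hr.
  have [m1 [x1 v1 a1]] := comp_expr_correct (ltnSn _) we hr he.
  have hr1 := rep_agree leF (ltnSn _) a1 hr.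
  eexists.
  + rewrite size_cat; apply: reaches_trans x1 _.
    rewrite /reaches; do 2! (erewrite exec1; [|eassumption|reflexivity]).
    by rewrite addnA addn2.
  + rewrite !updE /= v1 addn0; apply: rep_setr => //.
    exact: rep_tmp.
- case/and3P=> hq w1 w2 /code_at_cat[he1 hac] hr.
  have [ha /code_at_cat[he2 /code_at_cons[h _]]] :=
    @code_at_cat p _ (comp_addr q tmp) (comp_expr e2 tmp.+1 ++ [:: IStore tmp tmp.+1]) hac.
  have [m1 [x1 v1 a1]] := comp_expr_correct (ltnSn _) w1 hr he1.
  have hr1 := rep_agree leF (ltnSn _) a1 hr.
  have [m2 [x2 v2 a2]] := comp_addr_correct (ltnSn _) isT (let: And3 _ x _ := hr1 in x) ha.
  have hr2 := rep_agree leF (ltnSn _) a2 hr1.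
  have [m3 [x3 v3 a3]] := comp_expr_correct (d := 14) isT w2 hr2 he2.
  have hr3 := rep_agree (d := 14) leF isT a3 hr2.
  eexists.
  + apply: reaches_cast (reaches_trans x1 (reaches_trans x2 (reaches_trans x3 (_ :
      reaches 1 _ _ _ _)))) _ _.
    * by rewrite /reaches; erewrite exec1; [|eassumption|reflexivity].
    * by [].
    * by rewrite size_cat /= size_cat /=; lia.
  + rewrite v3 a3 // v2 v1; exact: rep_seta.
- case/andP=> w1 w2 /code_at_cat[h1 h2] hr.
  have [m1 x1 hr1] := IH1 _ _ _ w1 h1 hr.
  have [m2 x2 hr2] := IH2 _ _ _ w2 h2 hr1.
  exists m2 => //; rewrite size_cat addnA; exact: reaches_trans x1 x2.
- case/andP=> we wc /code_at_cat[he] /code_at_cons[hz hc] hr.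
  have [m1 [x1 v1 a1]] := comp_expr_correct (ltnSn _) we hr he.
  have hr1 := rep_agree leF (ltnSn _) a1 hr.
  case: ifP => E.
    exists m1 => //; rewrite size_cat; apply: reaches_trans x1 _.
    by rewrite /reaches; erewrite exec1; [|eassumption|reflexivity]; rewrite /= v1 E addnA addnS.
  have [m2 x2 hr2] := IH _ _ _ wc hc hr1.
  exists m2 => //; rewrite size_cat; apply: reaches_trans x1 _.
  rewrite /reaches; erewrite exec1; [|eassumption|reflexivity]; rewrite /= v1 E addnA addnS.
  exact: x2.
- case/and5P=> hv hw vw vc /and3P[wc we wfc] /code_at_cat[he].
  case/code_at_cons=> h1 /code_at_cons[h2] /code_at_cons[h3].
  set top := (off + size (comp_expr e tmp)).+3.
  case/code_at_cons=> h4 /code_at_cons[h5] /code_at_cat[hc].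
  case/code_at_cons=> h6 /code_at_cons[h7] /code_at_cons[h8 _] hr.
  have [m1 [x1 v1 a1]] := comp_expr_correct (ltnSn _) we hr he.
  have hr1 := rep_agree leF (ltnSn _) a1 hr.
  set N := eval e s; set s0 := setr v 0 _; set f := fun s' => incr v _.
  have fr j : regs (iter j f s0) v = j /\ regs (iter j f s0) w = N.
    elim: j => [|j [IHv IHw]] /=.
      by rewrite !updE !eqxx [w == v]eq_sym (negPf vw).
    rewrite !updE eqxx [w == v]eq_sym (negPf vw) !run_reg // IHv; split=> //.
  (* [T j] is the time of arrival at the loop head [top] after [j] rounds; the failing test at the
     end adds the last 2 steps. *)
  pose T j := size (comp_expr e tmp) + (3 +
      \sum_(j' < j) (2 + (cost c (iter j' f s0) + 3))).
  have inv j : j <= N -> exists2 m, reaches (T j) off mem top m & rep F (iter j f s0) m.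
    elim: j => [|j IHj] lej.
      rewrite /T big_ord0 addn0; eexists.
      + apply: reaches_trans x1 _.
        rewrite /reaches; do 3! (erewrite exec1; [|eassumption|reflexivity]).
        by [].
      + rewrite !updE /= v1 addn0; apply: rep_setr => //; apply: rep_setr => //.
        exact: rep_tmp.
    have [m2 x2 hr2] := IHj (ltnW lej); have [fv fw] := fr j.
    have mv : m2 v = j by rewrite (rep_reg hr2).
    have mw : m2 w = N by rewrite (rep_reg hr2).
    have hr3 : rep F (iter j f s0) (upd m2 tmp (N - j)).
      exact: rep_tmp.
    have [m3 x3 hr4] := IH _ _ _ wfc hc hr3.
    have m3v : m3 v = j by rewrite (rep_reg hr4) //; rewrite run_reg.
    have hr5 : rep F (run c (iter j f s0)) (upd m3 tmp 1).
      exact: rep_tmp.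
    have -> : T j.+1 = T j + (2 + (cost c (iter j f s0) + 3)).
      by rewrite /T big_ord_recr /=; lia.
    eexists.
    + apply: reaches_trans x2 _.
      apply: (@reaches_trans _ _ _ top.+2 _ _ (upd m2 tmp (N - j))).
        rewrite /reaches; erewrite exec1; [|eassumption|reflexivity].
        erewrite exec1; [|eassumption|reflexivity].
        by rewrite /= updE eqxx mv mw ifN //; lia.
      apply: reaches_trans x3 _.
      rewrite /reaches; do 3! (erewrite exec1; [|eassumption|reflexivity]).
      by rewrite /=.
    + have [vt tv] : (v == tmp) = false /\ (tmp == v) = false by split; lia.
      rewrite !updE vt eqxx m3v addn1 /= /f /incr -/f run_reg // fv.
      exact: rep_setr.
  have [m xm hrm] := inv N (leqnn N); have [fv fw] := fr N.
  have mv : m v = N by rewrite (rep_reg hrm).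
  have mw : m w = N by rewrite (rep_reg hrm).
  eexists.
  + have -> : forall a b : nat, a + (3 + (b + 2)) = a + (3 + b) + 2 by move=> *; lia.
    apply: reaches_trans xm _.
    do 2! (rewrite /reaches; erewrite exec1; [|eassumption|reflexivity]).
    rewrite /= updE eqxx mv mw subnn /= !size_cat /= /top size_cat /=.
    by congr RamState; lia.
  + exact: rep_tmp.
Qed.

End Compiler.

(** * Moving the input out of the registers *)

(** Unrolled, because no register is free for a loop counter while the low registers hold input.
    Register 0 is the address written last and register 1 the stride 8. *)
Definition save_regs (a k : nat) : seq instr :=
  flatten [seq [:: IAdd 0 0 1; IStore 0 i] | i <- iota a k].

(* The input initially occupies all registers.  With F = 8 * size x the arrays
   start beyond it, so each symbol can be copied to array 0 before its cell is
   reused; register 0, which holds size x, is the only register free at first.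
   144 is 8 * 18, the offset from F after saving registers 1, ..., 19. *)
Definition prelude : seq instr :=
  [:: IAdd 0 0 0; IAdd 0 0 0; IAdd 0 0 0; IStore 0 1; IConst 1 8]
  ++ save_regs 2 18
  ++ [:: IConst 2 144; ISub base_reg 0 2; IConst 3 reg_bound; IConst 2 1;
         ISub 4 base_reg 3; IJz 4 52; ILoad 5 3; IAdd 0 0 1; IStore 0 5; IAdd 3 3 2; IJmp 45].

(* The state once the first [i] symbols of [x] have been copied. *)
Definition saved (x : seq nat) (F i : nat) (mem : nat -> nat) : Prop :=
  [/\ mem 0 = F + 8 * i.-1, mem 1 = 8,
      forall r, i < r < F -> reg_bound <= r -> mem r = nth 0 x r.-1 &
      forall a q, q < 8 -> mem (F + 8 * a + q) = if (q == 0) && (a < i) then nth 0 x a else 0].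

Definition init_arr (x : seq nat) (q a : nat) : nat := if q == 0 then nth 0 x a else 0.

Section Prelude.
Variables (p : program) (x : seq nat).
Hypothesis szx : 3 < size x.
Let F := 8 * size x.

Lemma saved_low i mem r v :
  1 < r < reg_bound -> saved x F i mem -> saved x F i (upd mem r v).
Proof.
move=> hr [s0 s1 s2 s3]; split; rewrite ?updE.
- by rewrite ifN //; lia.
- by rewrite ifN //; lia.
- by move=> r' h1 h2; rewrite updE ifN ?s2 //; lia.
- by move=> a q hq; rewrite updE ifN ?s3 //; rewrite /F; lia.
Qed.

Lemma saved_step i mem :
  0 < i < F -> saved x F i mem ->
  saved x F i.+1 (upd (upd mem 0 (mem 0 + mem 1)) (mem 0 + mem 1) (nth 0 x i)).
Proof.
move=> hi [s0 s1 s2 s3].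
have E : mem 0 + mem 1 = F + 8 * i by rewrite s0 s1; lia.
rewrite E; split; rewrite ?updE.
- by rewrite ifN //; lia.
- by rewrite ifN ?ifN //; rewrite /F; lia.
- by move=> r h1 h2; rewrite !updE ifN ?ifN ?s2 //; lia.
- move=> a q hq; rewrite !updE; case: eqP => h.
    have [-> ->] : q = 0 /\ a = i by lia.
    by rewrite eqxx ltnSn.
  rewrite ifN ?s3 //; last by rewrite /F; lia.
  case: ifP => h1; first by rewrite ifT //; lia.
  by rewrite ifF //; lia.
Qed.

Lemma save_regs_correct k off i mem :
  0 < i -> i + k < reg_bound ->
  code_at p off (save_regs i.+1 k) -> saved x F i mem ->
  (forall r, i < r < reg_bound -> mem r = nth 0 x r.-1) ->
  exists2 mem', reaches p (2 * k) off mem (off + 2 * k) mem' & saved x F (i + k) mem'.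
Proof.
elim: k off i mem => [|k IH] off i mem i0 hk.
  by move=> _ h _; exists mem; rewrite ?muln0 ?addn0.
rewrite /save_regs /= => /code_at_cons[h1 /code_at_cons[h2 hc]] sv lo.
set m1 := upd (upd mem 0 (mem 0 + mem 1)) (mem 0 + mem 1) (nth 0 x i).
have hF : reg_bound <= F by rewrite /F; lia.
have sv1 : saved x F i.+1 m1 by apply: saved_step => //; lia.
have E : mem 0 + mem 1 = F + 8 * i by case: sv => -> ->; lia.
have [//|||m' x' sv'] := IH off.+2 i.+1 m1 _ _ hc sv1; first by lia.
  move=> r hr; rewrite /m1 !updE E ifN ?ifN ?lo //; try lia.
exists m'; last by rewrite -addSnnS.
have y : reaches p 2 off mem off.+2 m1.
  rewrite /reaches; do 2! (erewrite exec1; [|eassumption|reflexivity]).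
  by have lo1 : mem i.+1 = nth 0 x i by [rewrite lo //; lia]; rewrite /m1 -lo1.
apply: reaches_cast (reaches_trans y x') _ _; lia.
Qed.

(** The loop head is at 45 = 5 + 36 + 4, and 52 is the first address behind the prelude. A round
    takes 7 steps, the final test 2. *)
Lemma copy_loop k j mem :
  code_at p 45 (drop 45 prelude) ->
  j + k = F -> reg_bound <= j ->
  saved x F j.-1 mem -> mem 2 = 1 -> mem 3 = j -> mem base_reg = F ->
  exists mem', [/\ reaches p (7 * k + 2) 45 mem 52 mem', saved x F F.-1 mem' &
    mem' base_reg = F].
Proof.
rewrite [drop _ _]/=; do 7! case/code_at_cons => ?; move=> _.
elim: k j mem => [|k IH] j mem hj hb sv m2 m3 mF.
  exists (upd mem 4 0); split.
  - rewrite /reaches muln0 add0n; do 2! (erewrite exec1; [|eassumption|reflexivity]).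
    by rewrite !updE eqxx mF m3 -hj addn0 subnn.
  - by have <- : j.-1 = F.-1 by [lia]; apply: saved_low.
  - by [].
have E : mem 0 + mem 1 = F + 8 * j.-1 by case: sv => -> -> _ _; lia.
have mj : mem j = nth 0 x j.-1 by case: sv => _ _ h _; rewrite h //; lia.
pose m4 := upd mem 4 (F - j).
have sv4 : saved x F j.-1 m4 by apply: saved_low.
pose m5 := upd m4 5 (nth 0 x j.-1).
have sv5 : saved x F j.-1 m5 by apply: saved_low.
have := saved_step _ sv5; have -> : m5 0 + m5 1 = F + 8 * j.-1 by [].
set m6 := upd _ _ _ => sv6.
have {}sv6 : saved x F j (upd m6 3 j.+1).
  have jE : j.-1.+1 = j by lia.
  by apply: saved_low => //; rewrite -{1}jE; apply: sv6; rewrite /F; lia.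
have hF : reg_bound <= F by rewrite /F; lia.
have [|||||m' [x' sv' mF']] := IH j.+1 (upd m6 3 j.+1) _ _ sv6.
- lia.
- lia.
- by rewrite /m6 !updE /= ifN //; lia.
- by [].
- by rewrite /m6 !updE /= ifN //; lia.
exists m'; split => //.
have y1 : reaches p 3 45 mem 48 m5.
  rewrite /reaches /m5 /m4 -mj; erewrite exec1; [|eassumption|reflexivity].
  rewrite mF m3; erewrite exec1; [|eassumption|reflexivity].
  have -> : (upd mem 4 (F - j) 4 == 0) = false by rewrite updE eqxx; lia.
  erewrite exec1; [|eassumption|reflexivity].
  have -> : upd mem 4 (F - j) 3 = j by [].
  by rewrite [upd mem 4 _ j]updE ifN //; lia.
have y2 : reaches p 2 48 m5 50 m6.
  rewrite /reaches; do 2! (erewrite exec1; [|eassumption|reflexivity]).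
  have e0 : m5 0 + m5 1 = F + 8 * j.-1 by [].
  have -> : upd m5 0 (m5 0 + m5 1) 0 = m5 0 + m5 1 by [].
  by rewrite e0.
have m63 : m6 3 = j by rewrite /m6 !updE /= ifN //; lia.
have m62 : m6 2 = 1 by rewrite /m6 !updE /= ifN //; lia.
have y3 : reaches p 2 50 m6 45 (upd m6 3 j.+1).
  rewrite /reaches; do 2! (erewrite exec1; [|eassumption|reflexivity]).
  by rewrite m63 m62 addn1.
have y := reaches_trans y1 (reaches_trans y2 (reaches_trans y3 x')).
apply: reaches_cast y _ _; lia.
Qed.

Lemma prelude_correct :
  code_at p 0 prelude ->
  exists t mem' rg, [/\ t <= 64 * size x,
    exec p t (init_state x) = RamState (size prelude) mem' &
    rep F (State rg (init_arr x)) mem'].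
Proof.
have hF : reg_bound <= F by rewrite /F; lia.
have sF : size x < F by rewrite /F; lia.
move=> hp; have hl : code_at p 45 (drop 45 prelude) by move=> j hj; rewrite nth_drop; apply: (hp (45 + j)).
move: hp; rewrite {1}/prelude => /code_at_cat[h0 /code_at_cat[hs h1]].
set m0 := Defs.mem (init_state x).
have m0F a : F <= a -> m0 a = 0 by case: a => [|a] h; rewrite /m0 /=; rewrite ?nth_default //; lia.
pose m1 := upd (upd (upd (upd (upd m0 0 (m0 0 + m0 0)) 0 (4 * size x)) 0 F) F (nth 0 x 0)) 1 8.
have x1 : reaches p 5 0 m0 5 m1.
  move: h0; do 5! case/code_at_cons=> ?; move=> _.
  rewrite /reaches; do 3! (erewrite exec1; [|eassumption|reflexivity]).
  rewrite ![upd _ 0 _ 0]updE eqxx.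
  have -> : m0 0 + m0 0 + (m0 0 + m0 0) = 4 * size x by rewrite /m0 /=; lia.
  have -> : 4 * size x + 4 * size x = F by rewrite /F; lia.
  do 2! (erewrite exec1; [|eassumption|reflexivity]).
  by [].
have sv1 : saved x F 1 m1.
  split; rewrite /m1.
  - by rewrite !updE /= ifN ?addn0 //; lia.
  - by rewrite updE.
  - move=> r h h'; rewrite !updE !ifN; try lia.
    by rewrite /m0; case: r h h'.
  - move=> a q hq; rewrite !updE ifN; last lia.
    case: ifP => e.
      by have [-> ->] : q = 0 /\ a = 0 by lia.
    by rewrite !ifN ?m0F //; lia.
have lo1 r : 1 < r < reg_bound -> m1 r = nth 0 x r.-1.
  by move=> hr; rewrite /m1 !updE !ifN; try lia; rewrite /m0; case: r hr.
have [//|//|m2 x2 sv2] := save_regs_correct _ _ hs sv1 lo1.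
have [m20 m21 s2 s3] := sv2.
pose m3 := upd (upd (upd (upd m2 2 144) base_reg F) 3 reg_bound) 2 1.
have x3 : reaches p 4 41 m2 45 m3.
  move: h1; do 4! case/code_at_cons=> ?; move=> _.
  rewrite /reaches; do 2! (erewrite exec1; [|eassumption|reflexivity]).
  have -> : upd m2 2 144 0 - upd m2 2 144 2 = F by rewrite !updE /= m20; lia.
  by do 2! (erewrite exec1; [|eassumption|reflexivity]).
have sv3 : saved x F 19 m3 by do 4! apply: saved_low => //.
(* The loop stops at [F], the bound at hand, not at the end of the input. Cells in between hold 0,
   which is also what [init_arr] prescribes past the input. *)
have [|||||m4 [x4 sv4 mF]] := copy_loop (k := F - 20) (j := 20) hl _ _ sv3.
  by lia.
  by [].
  by [].
  by [].
  by [].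
exists (5 + (2 * 18 + (4 + (7 * (F - 20) + 2)))), m4, m4; split.
- by rewrite /F; lia.
- exact: reaches_trans x1 (reaches_trans x2 (reaches_trans x3 x4)).
- case: sv4 => _ _ _ s4; split=> // q a hq /=; rewrite s4 // /init_arr.
  case: eqP => //= _; case: ltnP => // h.
  by rewrite nth_default //; lia.
Qed.
End Prelude.

(** * The dynamic program *)

Notation vAns := 0.
Notation vPos := 1.
Notation vPow := 2.
Notation vIdx := 3.
Notation vOut := 4.
Notation vBase := 5.
Notation vI := 6.
Notation vK := 8.
Notation vJ := 10.

Infix ":+" := EAdd (at level 50, left associativity).
Infix ":-" := ESub (at level 50, left associativity).
Infix ";;" := Seq (at level 90, right associativity).
Coercion EConst : nat >-> expr.
Notation "! v" := (EVar v) (at level 8, v at level 2, format "! v").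
(* With b = l + 1, the arrays contain
   - weight[k * m + p]: the sum of b^i over the agents i disapproving p at step k;
   - maxdig[c]: the largest base-b digit of c < b^n;
   - bad[t * b^n + c]: whether code c violates a constraint at time t;
   - table[k * b^n + c]: whether code c is reachable after k steps.
   Register [vPow] runs through the powers b^i while parsing agent i, and ends
   at b^n; [vPos] is the position of the next unread input symbol. *)
Notation input := (EArr 0).
Notation weight := (EArr 1).
Notation maxdig := (EArr 2).
Notation bad := (EArr 3).
Notation table := (EArr 4).

Lemma run_seq c1 c2 s : run (c1 ;; c2) s = run c2 (run c1 s).
Proof. by []. Qed.
Lemma cost_seq c1 c2 s : cost (c1 ;; c2) s = cost c1 s + cost c2 (run c1 s).
Proof. by []. Qed.

Definition add_set : cmd :=
  For vJ vJ.+1 (input !vPos)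
    (Sto 1 (!vIdx :+ input (!vPos :+ 1 :+ !vJ))
           (weight (!vIdx :+ input (!vPos :+ 1 :+ !vJ)) :+ !vPow)).

(** Without multiplication, the row offset [k * m] in [vIdx] is kept by adding [m], which is
    [input 1]. *)
Definition next_set : cmd :=
  Asg vPos (!vPos :+ input !vPos :+ 1) ;; Asg vIdx (!vIdx :+ input 1).

Definition parse_agent : cmd :=
  Asg vIdx 0 ;; For vK vK.+1 (input 2) (add_set ;; next_set).

(* x + (y - x) is max x y for truncated subtraction. *)
Definition max_row : cmd :=
  For vJ vJ.+1 !vPow
    (Sto 2 !vOut (maxdig !vJ :+ (!vK :+ 1 :- maxdig !vJ)) ;;
     Asg vOut (!vOut :+ 1)).

Definition max_digits : cmd :=
  Asg vOut !vPow ;; For vK vK.+1 (input 2) max_row ;; Asg vPow !vOut.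

Definition parse : cmd :=
  Asg vPos 3 ;; Asg vPow 1 ;; For vI vI.+1 (input 0) (parse_agent ;; max_digits).

Definition mul_time : cmd :=
  Asg vBase 0 ;; For vK vK.+1 (input (!vPos :+ 1 :+ !vI :+ !vI)) (Asg vBase (!vBase :+ !vPow)).

Definition mark_bad : cmd :=
  For vK vK.+1 !vPow
    (If (maxdig !vK :- input (!vPos :+ 2 :+ !vI :+ !vI)) (Sto 3 (!vBase :+ !vK) 1)).

Definition constraints : cmd :=
  For vI vI.+1 (input !vPos) (mul_time ;; mark_bad).

Definition extend_code : cmd :=
  For vJ vJ.+1 (input 1)
    (Sto 4 (!vBase :+ !vPow :+ !vK :+ weight (!vIdx :+ !vJ)) 1).

(** Both entries are flags, so their truncated difference is nonzero exactly for a reachable code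
    that violates nothing. *)
Definition extend_layer : cmd :=
  For vK vK.+1 !vPow
    (If (table (!vBase :+ !vK) :- bad (!vBase :+ !vK)) extend_code).

(** Constraints at time [k] are enforced when layer [k] is extended; those at time [l] are therefore
    left to [answer]. *)
Definition search : cmd :=
  Sto 4 0 1 ;; Asg vBase 0 ;; Asg vIdx 0 ;;
  For vI vI.+1 (input 2)
    (extend_layer ;; Asg vBase (!vBase :+ !vPow) ;; Asg vIdx (!vIdx :+ input 1)).

Definition answer : cmd :=
  Asg vAns 0 ;;
  For vK vK.+1 !vPow
    (If (table (!vBase :+ !vK) :- bad (!vBase :+ !vK)) (Asg vAns 1)).

Definition solver : cmd := parse ;; constraints ;; search ;; answer.

Lemma wf_solver : wf solver.
Proof. by []. Qed.

(** * Results and costs of the pieces of the solver *)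

Definition ahead (s : state) (L : seq nat) : Prop :=
  forall u, arr s 0 (regs s vPos + u) = nth 0 L u.

Lemma has_iotaS (P : pred nat) j : has P (iota 0 j.+1) = has P (iota 0 j) || P j.
Proof. by rewrite -addn1 iotaD has_cat /= orbF. Qed.

Arguments upd f a v j /.

Section ParseSpec.
Variable Y : nat.
Hypothesis Y0 : 0 < Y.

Lemma add_set_spec s L rest :
  ahead s ((size L :: L) ++ rest) -> size L <= Y ->
  (forall a, arr (run add_set s) 1 a =
     arr s 1 a + regs s vPow * count (fun p => regs s vIdx + p == a) L) /\
  cost add_set s <= 70 * Y.
Proof.
move=> ah leY.
have e0 : eval (input !vPos) s = size L by have := ah 0; rewrite addn0.
have [|||||H C] := @for_rule (fun j s' => forall a, arr s' 1 a =
  arr s 1 a + regs s vPow * count (fun p => regs s vIdx + p == a) (take j L))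
  vJ vJ.+1 (input !vPos) (Sto 1 (!vIdx :+ input (!vPos :+ 1 :+ !vJ))
    (weight (!vIdx :+ input (!vPos :+ 1 :+ !vJ)) :+ !vPow)) s Y 51.
- by rewrite e0.
- by [].
- by [].
- by move=> a /=; rewrite take0 muln0 addn0.
- rewrite e0 => j s' hj [fr fa] vj IH; split=> [a|//].
  rewrite /= vj (fr vPos isT) (fr vIdx isT) (fr vPow isT) !(fa 0 isT).
  have -> : arr s 0 (regs s vPos + 1 + j) = nth 0 L j.
    by rewrite -addnA ah add1n /= nth_cat hj.
  rewrite (take_nth 0 hj) -cats1 count_cat /= mulnDr addnA addn0 IH.
  rewrite [a == _]eq_sym; case: eqP => [->|_]; first by rewrite muln1.
  by rewrite muln0 addn0.
- split=> [a|]; first by rewrite H e0 take_size.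
  by apply: leq_trans C _; rewrite /=; lia.
Qed.

Lemma add_next_spec s L rest :
  ahead s ((size L :: L) ++ rest) -> size L <= Y ->
  let s' := run (add_set ;; next_set) s in
  [/\ forall a, arr s' 1 a =
        arr s 1 a + regs s vPow * count (fun p => regs s vIdx + p == a) L,
      ahead s' rest, regs s' vIdx = regs s vIdx + arr s 0 1 &
      cost (add_set ;; next_set) s <= 100 * Y].
Proof.
move=> ah leY s'; rewrite {}/s'.
have [H C] := add_set_spec ah leY.
rewrite run_seq cost_seq; move: (run_frame add_set s) H.
move: (run add_set s) => s1 [fr fa] H.
have e0 : arr s 0 (regs s vPos) = size L by have := ah 0; rewrite addn0.
split.
- exact: H.
- move=> u; rewrite /= (fr vPos isT) !(fa 0 isT) e0 -!addnA ah add1n addnS /= nth_cat ifN ?addKn //.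
  lia.
- by rewrite /= (fr vIdx isT) (fa 0 isT).
- by have -> : cost next_set s1 = 29 by []; lia.
Qed.

Lemma parse_agent_spec s Ls rest :
  ahead s (flatten [seq size L :: L | L <- Ls] ++ rest) -> size Ls <= Y ->
  arr s 0 2 = size Ls -> all (fun L => size L <= Y) Ls ->
  let s' := run parse_agent s in
  [/\ forall a, arr s' 1 a = arr s 1 a + regs s vPow *
       \sum_(k < size Ls) count (fun p => k * arr s 0 1 + p == a) (nth [::] Ls k),
      ahead s' rest & cost parse_agent s <= 130 * Y ^ 2].
Proof.
move=> ah leY e2 /(all_nthP [::]) aL s'; rewrite {}/s'.
rewrite run_seq cost_seq; set s0 := run (Asg vIdx 0) s.
have [|||||[H1 H2 _] C] := @for_rule (fun j s' => [/\ forall a, arr s' 1 a =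
   arr s 1 a + regs s vPow *
     \sum_(k < j) count (fun p => k * arr s 0 1 + p == a) (nth [::] Ls k),
  ahead s' (flatten [seq size L :: L | L <- drop j Ls] ++ rest) &
  regs s' vIdx = j * arr s 0 1])
  vK vK.+1 (input 2) (add_set ;; next_set) s0 Y (100 * Y).
- by rewrite /= e2.
- by [].
- by [].
- split=> //= [a|]; first by rewrite big_ord0 muln0 addn0.
  by rewrite drop0.
- rewrite [eval _ _]/= e2 => j s' hj [fr fa] vj [I1 I2 I3].
  rewrite (drop_nth [::] hj) /= -catA in I2.
  have [J1 J2 J3 J4] := add_next_spec I2 (aL _ hj).
  split=> //; move: (run _ s') J1 J2 J3 => t J1 J2 J3; split=> [a|u|].
  + by rewrite /= J1 I1 I3 big_ord_recr mulnDr addnA [regs s' _]fr.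
  + by rewrite /= J2.
  + by rewrite /= J3 I3 [arr s' _ _]fa // mulSn addnC.
- split=> [a|//|].
    by rewrite H1 /= e2.
    by move: H2; rewrite /= e2 drop_size.
  by rewrite expnS expn1; move: C; rewrite /=; nia.
Qed.

Lemma max_row_spec s :
  regs s vPow <= regs s vOut -> regs s vPow <= Y ->
  let s' := run max_row s in
  [/\ forall a, arr s' 2 a = if regs s vOut <= a < regs s vOut + regs s vPow
        then maxn (arr s 2 (a - regs s vOut)) (regs s vK).+1 else arr s 2 a,
     regs s' vOut = regs s vOut + regs s vPow & cost max_row s <= 60 * Y].
Proof.
move=> le leY s'; rewrite {}/s' /max_row.
have [|||||[H1 H2] C] := @for_rule (fun j s' =>
  (forall a, arr s' 2 a = if regs s vOut <= a < regs s vOut + j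
        then maxn (arr s 2 (a - regs s vOut)) (regs s vK).+1 else arr s 2 a)
  /\ regs s' vOut = regs s vOut + j)
  vJ vJ.+1 !vPow (Sto 2 !vOut (maxdig !vJ :+ (!vK :+ 1 :- maxdig !vJ)) ;;
     Asg vOut (!vOut :+ 1)) s Y 39.
- by [].
- by [].
- by [].
- by split=> [a|]; rewrite /= ?addn0 //; case: ifP => //; lia.
- move=> j s' /= hj [fr fa] vj [I1 I2]; split=> //; split=> [a|].
    rewrite /= vj !I1 I2 (fr vK) // addn1 -maxnE.
    rewrite [X in maxn X _]ifF; last by lia.
    case: eqP => [->|ne]; first by rewrite addKn ifT //; lia.
    case: ifP => h; [rewrite ifT //; lia|rewrite ifF //; lia].
  by rewrite /= I2; lia.
- by split=> //; move: C; rewrite /=; lia.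
Qed.

Lemma max_digits_spec s (f : nat -> nat) :
  let B := regs s vPow in let l := arr s 0 2 in
  0 < B -> B * l.+1 <= Y -> l <= Y -> (forall c, c < B -> arr s 2 c = f c) ->
  let s' := run max_digits s in
  [/\ regs s' vPow = B * l.+1,
      forall c, c < B * l.+1 -> arr s' 2 c = maxn (f (c %% B)) (c %/ B) &
      cost max_digits s <= 90 * Y ^ 2].
Proof.
move=> B l B0 leBY lelY Hf s'; rewrite {}/s'.
rewrite 2!run_seq 2!cost_seq; set s0 := run (Asg vOut _) s.
have leB : B <= Y by apply: leq_trans leBY; rewrite mulnS leq_addr.
have [|||||[H1 H2] C] := @for_rule (fun j s' => regs s' vOut = B * j.+1 /\
   forall c, c < B * j.+1 -> arr s' 2 c = maxn (f (c %% B)) (c %/ B))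
  vK vK.+1 (input 2) max_row s0 Y (60 * Y).
- by [].
- by [].
- by [].
- split; rewrite /= muln1 // => c hc.
  by rewrite modn_small // divn_small // maxn0 Hf.
- rewrite [eval _ _]/= => j s' hj [fr fa] vj [I1 I2].
  have fB : regs s' vPow = B by rewrite fr.
  have [|| J1 J2 J3] := @max_row_spec s'.
  - by rewrite fB I1 leq_pmulr.
  - by rewrite fB.
  split=> //; move: (run _ s') J1 J2 => t J1 J2.
  split=> [|c hc]; first by rewrite /= J2 I1 fB [RHS]mulnS addnC.
  rewrite /= J1 I1 fB vj; case: ifP => h; last by apply: I2; lia.
  have hr : c - B * j.+1 < B by lia.
  (* In the new row the quotient by [B] is the digit [j.+1], and the remainder points into row 0,
     where the invariant gives [f]. *)
  have cE : c = j.+1 * B + (c - B * j.+1) by lia.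
  rewrite I2; last by nia.
  rewrite [in RHS]cE modnMDl divnMDl // !(modn_small hr) !(divn_small hr) maxn0.
  by rewrite addn0.
- move: H1 H2 C; set s1 := run (For _ _ _ _) s0 => H1 H2 C.
  split; [exact: H1 | exact: H2 |].
  by move: C; rewrite /=  expnS expn1; nia.
Qed.

(** For [c < b ^ i] this is the largest base-[b] digit. Recursion strips the top digit, mirroring
    how the table grows. *)
Fixpoint max_digit (b i c : nat) : nat :=
  if i is i'.+1 then maxn (max_digit b i' (c %% b ^ i')) (c %/ b ^ i') else 0.

(** Weights appear as sums over all steps, since members of arbitrary lists may make indices of
    different steps collide; [weight_index] later isolates the right step. *)
Lemma parse_spec s (Lss : seq (seq (seq nat))) rest :
  let l := arr s 0 2 in let m := arr s 0 1 in let n := size Lss in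
  arr s 0 0 = n ->
  (forall u, arr s 0 (3 + u) =
     nth 0 (flatten [seq flatten [seq size L :: L | L <- Ls] | Ls <- Lss] ++ rest) u) ->
  all (fun Ls => size Ls == l) Lss ->
  all (all (fun L => size L <= Y)) Lss ->
  l.+1 ^ n <= Y -> l <= Y -> n <= Y ->
  (forall a, arr s 1 a = 0) -> (forall a, arr s 2 a = 0) ->
  let s' := run parse s in
  [/\ forall a, arr s' 1 a = \sum_(i < n) l.+1 ^ i *
       \sum_(k < l) count (fun p => k * m + p == a) (nth [::] (nth [::] Lss i) k),
     forall c, c < l.+1 ^ n -> arr s' 2 c = max_digit l.+1 n c,
     regs s' vPow = l.+1 ^ n, ahead s' rest & cost parse s <= 250 * Y ^ 3].
Proof.
move=> l m n e0 hx /(all_nthP [::]) szl /(all_nthP [::]) szY leY lelY lenY z1 z2 s'.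
rewrite {}/s' 2!run_seq 2!cost_seq; set s0 := run _ (run _ s).
have [|||||[H1 H2 H3 H4] C] := @for_rule (fun i s' =>
  [/\ forall a, arr s' 1 a = \sum_(i' < i) l.+1 ^ i' *
       \sum_(k < l) count (fun p => k * m + p == a) (nth [::] (nth [::] Lss i') k),
     forall c, c < l.+1 ^ i -> arr s' 2 c = max_digit l.+1 i c,
     regs s' vPow = l.+1 ^ i & ahead s'
     (flatten [seq flatten [seq size L :: L | L <- Ls] | Ls <- drop i Lss] ++ rest)])
  vI vI.+1 (input 0) (parse_agent ;; max_digits) s0 Y (220 * Y ^ 2).
- by rewrite /= e0.
- by [].
- by [].
- split=> [a|c _||u]; rewrite /= ?big_ord0 ?z1 ?z2 //.
  by rewrite drop0 -hx.
- rewrite [eval _ _]/= e0 => i s' hi [fr fa] vi [I1 I2 I3 I4].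
  rewrite run_seq cost_seq.
  rewrite (drop_nth [::] hi) /= -catA in I4.
  have szi := eqP (szl _ hi).
  have s2 : arr s' 0 2 = l by rewrite fa.
  have s1 : arr s' 0 1 = m by rewrite fa.
  have [|||J1 J2 J3] := parse_agent_spec I4.
  - by rewrite szi.
  - by rewrite szi.
  - exact: szY.
  move: (run_frame parse_agent s') J1 J2 => [gr ga].
  move: (run parse_agent s') gr ga => t gr ga J1 J2.
  have t2 : arr t 0 2 = l by rewrite ga.
  have tP : regs t vPow = l.+1 ^ i by rewrite gr.
  have leb : l.+1 ^ i * l.+1 <= Y.
    by rewrite -expnSr; apply: leq_trans leY; apply: leq_pexp2l.
  have [||||K1 K2 K3] := @max_digits_spec t (max_digit l.+1 i).
  - by rewrite tP expn_gt0.
  - by rewrite tP t2.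
  - by rewrite t2.
  - by rewrite tP => c hc; rewrite ga // I2.
  rewrite tP t2 in K1 K2.
  split; last by lia.
  move: (run_frame max_digits t) K1 K2 => [hr ha].
  move: (run max_digits t) hr ha => t' hr ha K1 K2.
  split=> [a|c hc||u].
  + by rewrite /= (ha 1) // J1 I1 I3 big_ord_recr s1 szi.
  + by rewrite /= K2 -?expnSr.
  + by rewrite /= K1 -expnSr.
  + by rewrite /= (ha 0) // (hr vPos) // J2.
- move: H1 H2 H3 H4 C; rewrite -/(run _ s0) [eval _ _]/= e0.
  set s1 := run (For _ _ _ _) s0 => H1 H2 H3 H4 C; split=> //.
    by move: H4; rewrite drop_size.
  move: C; rewrite /= !expnS expn0 muln1; nia.
Qed.

End ParseSpec.

Section SearchSpec.
Variable Y : nat.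
Hypothesis Y0 : 0 < Y.

Lemma nth_flatten_pairs (A : seq (nat * nat)) j :
  nth 0 (flatten [seq [:: c.1; c.2] | c <- A]) (j + j) = (nth (0, 0) A j).1 /\
  nth 0 (flatten [seq [:: c.1; c.2] | c <- A]) (j + j).+1 = (nth (0, 0) A j).2.
Proof.
elim: A j => [|c A IH] [|j] //; rewrite addSn addnS; exact: IH.
Qed.

Lemma mul_time_spec s :
  let a := arr s 0 (regs s vPos + 1 + regs s vI + regs s vI) in
  a <= Y ->
  let s' := run mul_time s in
  regs s' vBase = a * regs s vPow /\ cost mul_time s <= 40 * Y.
Proof.
move=> a leY s'; rewrite {}/s' run_seq cost_seq; set s0 := run (Asg _ _) s.
have [|||||H C] := @for_rule (fun j s' => regs s' vBase = j * regs s vPow)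
  vK vK.+1 (input (!vPos :+ 1 :+ !vI :+ !vI)) (Asg vBase (!vBase :+ !vPow)) s0 Y 7.
- by [].
- by [].
- by [].
- by [].
- move=> j s' hj [fr fa] vj IH; split=> //.
  by rewrite /= IH (fr vPow) // mulSn addnC.
- split; first exact: H.
  by move: C; rewrite /=; lia.
Qed.

Lemma mark_bad_spec s (f : nat -> nat) (B0 : nat -> bool) :
  let lam := arr s 0 (regs s vPos + 2 + regs s vI + regs s vI) in
  regs s vPow <= Y ->
  (forall c, c < regs s vPow -> arr s 2 c = f c) ->
  (forall a, arr s 3 a = B0 a) ->
  let s' := run mark_bad s in
  (forall a, arr s' 3 a = B0 a || [&& regs s vBase <= a, a < regs s vBase + regs s vPow
     & lam < f (a - regs s vBase)]) /\ cost mark_bad s <= 60 * Y.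
Proof.
move=> lam leY Hf HB s'; rewrite {}/s' /mark_bad.
have [|||||H C] := @for_rule (fun j s' => forall a, arr s' 3 a =
   B0 a || [&& regs s vBase <= a, a < regs s vBase + j & lam < f (a - regs s vBase)])
  vK vK.+1 !vPow (If (maxdig !vK :- input (!vPos :+ 2 :+ !vI :+ !vI))
    (Sto 3 (!vBase :+ !vK) 1)) s Y 45.
- by [].
- by [].
- by [].
- by move=> a /=; rewrite addn0 HB; case: leqP; rewrite ?orbF //= => h; rewrite ltnNge h orbF.
- rewrite [eval _ _]/= => j s' hj [fr fa] vj IH; split; last by rewrite /=; case: ifP.
  move=> a /=; rewrite vj (fa 2) // (fa 0) // (fr vPos) // (fr vI) // -/lam Hf // subn_eq0.
  case: (leqP (f j) lam) => h /=; rewrite IH ?(fr vBase) //.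
    congr nat_of_bool; congr (_ || _); rewrite addnS ltnS.
    case E : (a == regs s vBase + j); last by lia.
    by rewrite (eqP E) addKn [lam < _]ltnNge h ltnn !andbF.
  case: eqP => [->|ne]; last by congr nat_of_bool; congr (_ || _); lia.
  by rewrite addKn h addnS ltnSn leq_addr orbT.
- by split=> //; move: C; rewrite /=; lia.
Qed.

Definition bad_at (B : nat) (f : nat -> nat) (A : seq (nat * nat)) (a : nat) : bool :=
  has (fun tl => [&& tl.1 * B <= a, a < tl.1 * B + B & tl.2 < f (a - tl.1 * B)]) A.

Lemma constraints_spec s (f : nat -> nat) (A : seq (nat * nat)) :
  let B := regs s vPow in
  B <= Y -> size A <= Y -> all (fun c => c.1 <= Y) A ->
  ahead s (size A :: flatten [seq [:: c.1; c.2] | c <- A]) ->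
  (forall c, c < B -> arr s 2 c = f c) ->
  (forall a, arr s 3 a = 0) ->
  let s' := run constraints s in
  (forall a, arr s' 3 a = bad_at B f A a) /\ cost constraints s <= 130 * Y ^ 2.
Proof.
move=> B leBY leAY /(all_nthP (0, 0)) leY ah Hf z s'; rewrite {}/s' /constraints.
have e0 : eval (input !vPos) s = size A by have := ah 0; rewrite addn0.
have [|||||H C] := @for_rule (fun j s' => forall a, arr s' 3 a = bad_at B f (take j A) a)
  vI vI.+1 (input !vPos) (mul_time ;; mark_bad) s Y (100 * Y).
- by rewrite e0.
- by [].
- by [].
- by move=> a /=; rewrite take0 z.
- rewrite e0 => j s' hj [fr fa] vj IH.
  have [n1 n2] := nth_flatten_pairs A j.
  have t1 : arr s' 0 (regs s' vPos + 1 + regs s' vI + regs s' vI) = (nth (0, 0) A j).1.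
    by rewrite vj fa // fr // -!addnA ah add1n.
  have t2 : arr s' 0 (regs s' vPos + 2 + regs s' vI + regs s' vI) = (nth (0, 0) A j).2.
    by rewrite vj fa // fr // -!addnA ah add2n.
  have [|J1 J2] := @mul_time_spec s'; first by rewrite t1; apply: leY.
  rewrite run_seq cost_seq; move: (run_frame mul_time s') J1 => [gr ga].
  move: (run mul_time s') gr ga => t gr ga J1.
  have tP : regs t vPow = B by rewrite gr // fr.
  have [|c hc|a|K1 K2] := @mark_bad_spec t f (bad_at B f (take j A)).
  - by rewrite tP.
  - by rewrite ga // fa // Hf -?tP.
  - by rewrite ga.
  rewrite (gr vPos isT) (gr vI isT) (ga 0 isT) t2 J1 t1 tP (fr vPow isT) in K1.
  split; last by lia.
  move=> a; rewrite [LHS]/= -/(run mark_bad t) K1 (take_nth (0, 0) hj) -cats1.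
  by rewrite /bad_at has_cat /= orbF.
- split=> [a|]; first by rewrite H e0 take_size.
  by move: C; rewrite /= expnS expn1; nia.
Qed.

Section Reach.
Variables (m B : nat) (w : nat -> nat -> nat) (bd : nat -> nat -> bool).

(** Predecessors range over codes below [B], as in the loop of [extend_layer]; [reach_lt] shows that
    no reachable code is lost thereby. *)
Fixpoint reach (k c : nat) : bool :=
  if k is k'.+1 then
    has (fun c' => [&& reach k' c', ~~ bd k' c' &
      has (fun p => c' + w k' p == c) (iota 0 m)]) (iota 0 B)
  else c == 0.

End Reach.

(** Preservation below [top] is what allows the current layer to be read while the next one is being
    filled. *)
Lemma extend_code_spec s (g : nat -> bool) :
  let top := regs s vBase + regs s vPow in
  arr s 0 1 <= Y ->
  (forall a, arr s 4 (top + a) = g a) ->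
  let s' := run extend_code s in
  [/\ forall a, arr s' 4 (top + a) = g a ||
        has (fun p => regs s vK + arr s 1 (regs s vIdx + p) == a) (iota 0 (arr s 0 1)),
      forall a, a < top -> arr s' 4 a = arr s 4 a & cost extend_code s <= 50 * Y].
Proof.
move=> top leY Hg s'; rewrite {}/s' /extend_code.
have [|||||[H1 H2] C] := @for_rule (fun j s' =>
    (forall a, arr s' 4 (top + a) = g a ||
        has (fun p => regs s vK + arr s 1 (regs s vIdx + p) == a) (iota 0 j)) /\
    (forall a, a < top -> arr s' 4 a = arr s 4 a))
  vJ vJ.+1 (input 1)
    (Sto 4 (!vBase :+ !vPow :+ !vK :+ weight (!vIdx :+ !vJ)) 1) s Y 32.
- by [].
- by [].
- by [].
- by split=> //= a; rewrite orbF.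
- rewrite [eval _ _]/= => j s' hj [fr fa] vj [I1 I2]; split=> //.
  split=> a => [|ha]; rewrite ?has_iotaS /= vj (fa 1 isT)
     (fr vBase isT) (fr vPow isT) (fr vK isT) (fr vIdx isT) -/top.
    rewrite I1 -addnA eqn_add2l eq_sym.
    by case: eqP => // _; rewrite ?orbT ?orbF.
  by rewrite ifN ?I2 //; lia.
- by split=> //; move: C; rewrite /=; lia.
Qed.

Lemma extend_layer_spec s (r bd : nat -> bool) (w : nat -> nat) :
  let B := regs s vPow in let base := regs s vBase in let m := arr s 0 1 in
  m <= Y -> B <= Y ->
  (forall c, c < B -> arr s 4 (base + c) = r c) ->
  (forall c, c < B -> arr s 3 (base + c) = bd c) ->
  (forall p, p < m -> arr s 1 (regs s vIdx + p) = w p) ->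
  (forall a, arr s 4 (base + B + a) = 0) ->
  let s' := run extend_layer s in
  (forall a, arr s' 4 (base + B + a) =
     has (fun c => [&& r c, ~~ bd c & has (fun p => c + w p == a) (iota 0 m)]) (iota 0 B))
  /\ cost extend_layer s <= 100 * Y ^ 2.
Proof.
move=> B base m lemY leBY Hr Hb Hw z s'; rewrite {}/s' /extend_layer.
pose g j a := has (fun c => [&& r c, ~~ bd c & has (fun p => c + w p == a) (iota 0 m)]) (iota 0 j).
have [|||||[H1 H2] C] := @for_rule (fun j s' =>
    (forall a, arr s' 4 (base + B + a) = g j a) /\
    (forall a, a < base + B -> arr s' 4 a = arr s 4 a))
  vK vK.+1 !vPow
    (If (table (!vBase :+ !vK) :- bad (!vBase :+ !vK)) extend_code) s Y (80 * Y).
- by [].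
- by [].
- by [].
- by split=> //= a; rewrite z.
- rewrite [eval _ _]/= => j s' hj [fr fa] vj [I1 I2].
  have ev : eval (table (!vBase :+ !vK) :- bad (!vBase :+ !vK)) s' = r j && ~~ bd j.
    rewrite /= vj (fa 3) // (fr vBase) // I2 ?ltn_add2l // Hr // Hb //.
    by case: (r j) (bd j) => [] [].
  have sB : regs s' vBase + regs s' vPow = base + B by rewrite !fr.
  have [||J1 J2 J3] := @extend_code_spec s' (g j).
  - by rewrite fa.
  - by rewrite sB.
  rewrite sB in J1 J2.
  have cst x : cost (If x extend_code) s' = size (comp_expr x tmp) + (1 + if eval x s' == 0 then 0 else cost extend_code s') by [].
  have rn x : run (If x extend_code) s' = if eval x s' == 0 then s' else run extend_code s' by [].
  rewrite rn cst ev; split; last by case: ifP => _; rewrite [size _]/=; lia.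
  case E : (r j && ~~ bd j); rewrite [_ == 0]/=.
    move: J1 J2; move: (run extend_code s') => t J1 J2; split=> a => [|ha].
      rewrite J1 /g has_iotaS -/(g j a) andbA E /=; congr (nat_of_bool (_ || _)).
      rewrite (fa 0 isT); apply: eq_in_has => p; rewrite mem_iota add0n => /andP[_ hp].
      by rewrite vj (fr vIdx) // (fa 1) // Hw.
    by rewrite J2 ?I2.
  split=> a => [|ha]; last by rewrite I2.
  by rewrite I1 /g has_iotaS andbA E orbF.
- split=> [a|]; first exact: H1.
  by move: C; rewrite /= expnS expn1; nia.
Qed.

Lemma search_spec s (w : nat -> nat -> nat) (bd : nat -> nat -> bool) :
  let B := regs s vPow in let m := arr s 0 1 in let l := arr s 0 2 in
  let rch := reach m B w bd in
  0 < B -> m <= Y -> B <= Y -> l <= Y ->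
  (forall k c, k < l -> c < B -> arr s 3 (k * B + c) = bd k c) ->
  (forall k p, k < l -> p < m -> arr s 1 (k * m + p) = w k p) ->
  (forall k c p, k < l -> c < B -> p < m -> rch k c -> c + w k p < B) ->
  (forall a, arr s 4 a = 0) ->
  let s' := run search s in
  [/\ forall c, c < B -> arr s' 4 (l * B + c) = rch l c, regs s' vBase = l * B &
      cost search s <= 160 * Y ^ 3].
Proof.
move=> B m l rch B0 lemY leBY lelY Hb Hw Hbd z s'; rewrite {}/s'.
rewrite 3!run_seq 3!cost_seq; set s0 := run _ (run _ (run _ s)).
have [|||||[H1 H2 H3 H4] C] := @for_rule (fun k s' =>
   [/\ forall c, c < B -> arr s' 4 (k * B + c) = rch k c,
       forall a, arr s' 4 (k * B + B + a) = 0,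
       regs s' vBase = k * B & regs s' vIdx = k * m])
  vI vI.+1 (input 2) (extend_layer ;; Asg vBase (!vBase :+ !vPow) ;; Asg vIdx (!vIdx :+ input 1))
  s0 Y (120 * Y ^ 2).
- by [].
- by [].
- by [].
- by split=> [c hc|a||] //=; rewrite mul0n ?add0n ?z //; case: eqP => //; lia.
- rewrite [eval _ _]/= => k s' hk [fr fa] vk [I1 I2 I3 I4].
  have sP : regs s' vPow = B by rewrite fr.
  have [|||||| J1 J2] := @extend_layer_spec s' (rch k) (bd k) (w k).
  - by rewrite fa.
  - by rewrite sP.
  - by rewrite sP I3; exact: I1.
  - by rewrite sP I3 => c hc; rewrite fa // [arr _ _ _]Hb.
  - by rewrite I4 => p hp; rewrite fa // [arr _ _ _]Hw // -[m](fa 0).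
  - by rewrite I3 sP.
  have s1 : arr s' 0 1 = m by rewrite fa.
  rewrite I3 sP s1 in J1.
  rewrite !run_seq !cost_seq; move: (run_frame extend_layer s') J1 => [gr ga].
  move: (run extend_layer s') gr ga => t gr ga J1; split; last first.
    rewrite [X in _ + X <= _]/=; move: J2; rewrite expnS expn1; nia.
  split=> [c hc|a||] /=.
  - by rewrite mulSn [B + _]addnC J1.
  (* Layer [k + 2] must still be empty: a write there would come from a sum of at least [B], which
     [Hbd] excludes. *)
  - have -> : k.+1 * B + B + a = k * B + B + (B + a) by rewrite mulSn; lia.
    rewrite J1; case: hasP => //= -[c]; rewrite mem_iota add0n => /andP[_ hc].
    case/and3P=> h1 h2 /hasP[p]; rewrite mem_iota add0n => /andP[_ hp] /eqP e.
    by have := Hbd k c p hk hc hp h1; rewrite e; lia.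
  - by rewrite gr // I3 gr // sP mulSn addnC.
  - by rewrite gr // I4 ga // s1 mulSn addnC.
- move: H1 H3 C; rewrite [eval _ _]/= -/l; set s1 := run (For _ _ _ _) s0 => H1 H3 C.
  by split=> //; move: C; rewrite /= !expnS expn0 muln1; nia.
Qed.

Lemma answer_spec s (r bd : nat -> bool) :
  let B := regs s vPow in let base := regs s vBase in
  B <= Y ->
  (forall c, c < B -> arr s 4 (base + c) = r c) ->
  (forall c, c < B -> arr s 3 (base + c) = bd c) ->
  let s' := run answer s in
  regs s' vAns = has (fun c => r c && ~~ bd c) (iota 0 B) /\
  cost answer s <= 50 * Y.
Proof.
move=> B base leBY Hr Hb s'; rewrite {}/s' run_seq cost_seq; set s0 := run _ s.
have [|||||H C] := @for_rule (fun j s' =>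
    regs s' vAns = has (fun c => r c && ~~ bd c) (iota 0 j))
  vK vK.+1 !vPow
    (If (table (!vBase :+ !vK) :- bad (!vBase :+ !vK)) (Asg vAns 1)) s0 Y 30.
- by [].
- by [].
- by [].
- by [].
- rewrite [eval _ _]/= => j s' hj [fr fa] vj IH; split; last by rewrite /=; case: ifP.
  rewrite has_iotaS /= vj (fa 3) // (fa 4) // (fr vBase) // [arr _ 4 _]Hr // [arr _ 3 _]Hb //.
  by case: (r j) (bd j) => [] [] /=; rewrite ?IH ?orbT ?orbF.
- by split; [exact: H|move: C; rewrite /=; lia].
Qed.

End SearchSpec.

(** * Codes of disagreement vectors *)

(** The sum is the code with all digits 1 in base [b.+1]; [b] times it has all digits [b] and is the
    largest number with [n] digits. *)
Lemma repunit b n : b * (\sum_(i < n) b.+1 ^ i) + 1 = b.+1 ^ n.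
Proof.
elim: n => [|n IH]; first by rewrite big_ord0 muln0.
by rewrite big_ord_recr /= mulnDr expnS mulSn -[X in _ = X + _]IH addnAC.
Qed.

Lemma max_digit_code b n (d : nat -> nat) :
  (forall i, i < n -> d i < b) ->
  max_digit b n (\sum_(i < n) b ^ i * d i) = \max_(i < n) d i /\
  \sum_(i < n) b ^ i * d i < b ^ n.
Proof.
elim: n => [|n IH] hd; first by rewrite !big_ord0.
have b0 : 0 < b by apply: leq_ltn_trans (hd 0 _).
have [IH1 IH2] := IH (fun i hi => hd i (ltnW hi)).
rewrite !big_ord_recr /= [b ^ n * _]mulnC.
have h := hd n (ltnSn _); split.
  by rewrite addnC modnMDl divnMDl ?expn_gt0 ?b0 // modn_small // divn_small // addn0 IH1.
have hb : d n * b ^ n + b ^ n <= b * b ^ n by rewrite -mulSnr leq_mul2r h orbT.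
by rewrite expnS; apply: leq_trans hb; rewrite addnC ltn_add2l.
Qed.

Section Reachable.
Variables (m B l : nat) (w : nat -> nat -> nat) (bd : nat -> nat -> bool).
Hypothesis B0 : 0 < B.
Hypothesis stay : forall k c p, k < l -> c < B -> p < m -> reach m B w bd k c -> c + w k p < B.

Lemma reach_lt k c : k <= l -> reach m B w bd k c -> c < B.
Proof.
elim: k c => [|k IH] c hk /=; first by move/eqP->.
case/hasP=> c'; rewrite mem_iota => /andP[_ hc'] /and3P[hr _] /hasP[p].
by rewrite mem_iota => /andP[_ hp] /eqP<-; apply: stay.
Qed.

(** Only prefixes shorter than [k] are tested. Choices are functions on [nat], so that one function
    serves all prefixes and extending it changes a single value. *)
Lemma reachP k c : k <= l ->
  reach m B w bd k c <-> exists o : nat -> nat, [/\ forall j, j < k -> o j < m,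
    c = \sum_(j < k) w j (o j) & forall t, t < k -> ~~ bd t (\sum_(j < t) w j (o j))].
Proof.
elim: k c => [|k IH] c hk.
  split=> [/eqP->|[o [_ -> _]]]; last by rewrite big_ord0.
  by exists (fun=> 0); split=> //; rewrite big_ord0.
split=> [/hasP[c']|[o [ho -> hb]]].
  rewrite mem_iota => /andP[_ hc'] /and3P[/IH-/(_ (ltnW hk))[o [o1 o2 o3]] hb] /hasP[p].
  rewrite mem_iota => /andP[_ hp] /eqP<-.
  pose o' j := if j == k then p else o j.
  have E t : t <= k -> \sum_(j < t) w j (o' j) = \sum_(j < t) w j (o j).
    move=> ht; apply: eq_bigr => j _; rewrite /o' ifN //.
    by have := ltn_ord j; lia.
  exists o'; split=> [j hj||t].
  - rewrite /o'; case: eqP => // ne; apply: o1; lia.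
  - by rewrite big_ord_recr /= E // -o2 /o' eqxx.
  - rewrite ltnS leq_eqVlt => /orP[/eqP->|ht]; first by rewrite E // -o2.
    by rewrite E ?o3 // ltnW.
have hr : reach m B w bd k (\sum_(j < k) w j (o j)).
  apply/(IH _ (ltnW hk)); exists o; split=> // [j hj|t ht]; first by apply: ho; lia.
  by apply: hb; lia.
apply/hasP; exists (\sum_(j < k) w j (o j)).
  by rewrite mem_iota /= (reach_lt (ltnW hk)).
apply/and3P; split; [exact: hr | exact: hb |].
apply/hasP; exists (o k); first by rewrite mem_iota /= ho.
by rewrite big_ord_recr.
Qed.

End Reachable.

Section Weights.
Variables (l m : nat) (Lss : seq (seq (seq nat))) (A : seq (nat * nat)).
Let n := size Lss.

Definition set_at (i k : nat) : seq nat := nth [::] (nth [::] Lss i) k.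

Definition code_weight (k p : nat) : nat :=
  \sum_(i < n) l.+1 ^ i * count_mem p (set_at i k).

Definition violates (t c : nat) : bool :=
  has (fun tl => (tl.1 == t) && (tl.2 < max_digit l.+1 n c)) A.

Hypothesis lt_m : forall i k p, p \in set_at i k -> p < m.
Hypothesis uniq_set : forall i k, uniq (set_at i k).

(** Members are below [m], so division by [m] recovers the step from the index and all other terms
    vanish. *)
Lemma weight_index k p : k < l -> p < m ->
  \sum_(i < n) l.+1 ^ i * \sum_(k' < l) count (fun p' => k' * m + p' == k * m + p) (set_at i k')
  = code_weight k p.
Proof.
move=> hk hp; apply: eq_bigr => i _; congr (_ * _).
rewrite (bigD1 (Ordinal hk)) //= [X in _ + X]big1 ?addn0.
  by apply: eq_count => p' /=; rewrite eqn_add2l.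
move=> k' ne; apply/eqP; rewrite -leqn0 leqNgt -has_count; apply/hasPn => p' /lt_m hp'.
apply: contra ne => /eqP e; apply/eqP/val_inj => /=.
have m0 : 0 < m by lia.
by have := congr1 (divn^~ m) e; rewrite !divnMDl // !divn_small // !addn0.
Qed.

Lemma code_weight_le k p : code_weight k p <= \sum_(i < n) l.+1 ^ i.
Proof.
apply: leq_sum => i _; rewrite -[leqRHS]muln1 leq_mul2l count_uniq_mem //.
by case: (_ \in _); rewrite orbT.
Qed.

(** Sets have no repetitions, so a step adds at most the all-ones code. After at most [l] steps the
    code is at most [l] times that, which is [l.+1 ^ n - 1] by [repunit]. *)
Lemma reach_stay k c p : k < l ->
  reach m (l.+1 ^ n) code_weight violates k c -> c + code_weight k p < l.+1 ^ n.
Proof.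
move=> hk hr; have {hr} : c <= k * \sum_(i < n) l.+1 ^ i.
  elim: k c hr {hk} => [|k IH] c /=; first by move/eqP->.
  case/hasP=> c' _ /and3P[/IH hc _ /hasP[q _ /eqP<-]].
  by rewrite mulSn addnC leq_add ?code_weight_le.
have := repunit l n; have := code_weight_le k p; move: (\sum_(i < n) _) => E; nia.
Qed.

Lemma bad_at_index t c : c < l.+1 ^ n ->
  bad_at (l.+1 ^ n) (max_digit l.+1 n) A (t * l.+1 ^ n + c) = violates t c.
Proof.
move=> hc; apply: eq_has => -[t' lam] /=; case: eqP => [->|ne] /=.
  by rewrite leq_addr ltn_add2l hc addKn.
by apply/negP => /and3P[h1 h2 _]; apply: ne; nia.
Qed.

(** Only the arrays of [s] are specified: the prelude leaves arbitrary values in the registers, and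
    the solver initialises those it uses. *)
Lemma solver_spec Y s :
  let x := [:: n; m; l] ++
    flatten [seq flatten [seq size L :: L | L <- Ls] | Ls <- Lss] ++
    size A :: flatten [seq [:: c.1; c.2] | c <- A] in
  arr s = init_arr x ->
  all (fun Ls => size Ls == l) Lss ->
  all (all (fun L => size L <= Y)) Lss ->
  all (fun c => c.1 <= Y) A -> size A <= Y ->
  0 < Y -> l.+1 ^ n <= Y -> l <= Y -> n <= Y -> m <= Y ->
  let s' := run solver s in
  regs s' 0 = has (fun c => reach m (l.+1 ^ n) code_weight violates l c && ~~ violates l c)
               (iota 0 (l.+1 ^ n)) /\
  cost solver s <= 590 * Y ^ 3.
Proof.
move=> x sx szl szY tY AY Y0 BY lY nY mY s'; rewrite {}/s'.
have B0 : 0 < l.+1 ^ n by rewrite expn_gt0.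
have x0 : arr s 0 0 = n by rewrite sx.
have x1 : arr s 0 1 = m by rewrite sx.
have x2 : arr s 0 2 = l by rewrite sx.
have [u||||||a|a|P1 P2 P3 P4 P5] := @parse_spec Y Y0 s Lss
  (size A :: flatten [seq [:: c.1; c.2] | c <- A]) x0; rewrite ?x2 ?sx //.
rewrite x1 x2 in P1 P2 P3.
have -> : run solver s = run answer (run search (run constraints (run parse s))) by [].
have -> : cost solver s = cost parse s + (cost constraints (run parse s) +
  (cost search (run constraints (run parse s)) +
   cost answer (run search (run constraints (run parse s))))) by [].
move: (run_frame parse s) P1 P2 P3 P4 => [f1 g1].
move: (run parse s) f1 g1 => s1 f1 g1 P1 P2 P3 P4.
have [||||c hc|a|C1 C2] := @constraints_spec Y Y0 s1 (max_digit l.+1 n) A; rewrite ?P3 //.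
- by rewrite P2 // -P3.
- by rewrite g1 // sx.
rewrite P3 in C1.
move: (run_frame constraints s1) C1 => [f2 g2].
move: (run constraints s1) f2 g2 => s2 f2 g2 C1.
have pB : regs s2 vPow = l.+1 ^ n by rewrite f2.
have y1 : arr s2 0 1 = m by rewrite g2 // g1.
have y2 : arr s2 0 2 = l by rewrite g2 // g1.
have [||||k c hk hc|k p hk hp|k c p hk hc hp|a|S1 S2 S3] :=
  @search_spec Y Y0 s2 code_weight violates; rewrite ?pB ?y1 ?y2 //.
- by rewrite C1 bad_at_index -?pB.
- by rewrite g2 // P1 weight_index -?y1 -?y2.
- by apply: reach_stay; rewrite -y2.
- by rewrite g2 // g1 // sx.
rewrite pB y1 y2 in S1 S2.
move: (run_frame search s2) S1 S2 => [f3 g3].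
move: (run search s2) f3 g3 => s3 f3 g3 S1 S2.
have pB3 : regs s3 vPow = l.+1 ^ n by rewrite f3.
have [|c hc|c hc|T1 T2] := @answer_spec Y Y0 s3
  (reach m (l.+1 ^ n) code_weight violates l) (violates l); rewrite ?pB3 ?S2 //.
- by rewrite S1 -?pB3.
- by rewrite g3 // C1 bad_at_index -?pB3.
rewrite T1 pB3; split=> //.
move: P5 C2 S3 T2; rewrite !expnS expn0 muln1; nia.
Qed.

End Weights.

(** * Outcomes of an encoded instance and their codes *)

Section Encoding.
Variables (I : instance) (A : seq (nat * nat)).
Let n := n_agents I.
Let m := m_projects I.
Let l := l_steps I.

Definition sets : seq (seq (seq nat)) :=
  [seq [seq [seq val p | p <- enum (disapp i k)] | k <- enum 'I_l] | i <- enum 'I_n].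

Lemma size_sets : size sets = n.
Proof. by rewrite size_map size_enum_ord. Qed.

Lemma set_atE (i : 'I_n) (k : 'I_l) : set_at sets i k = [seq val p | p <- enum (disapp i k)].
Proof.
rewrite /set_at (nth_map i) ?size_enum_ord // (nth_map k) ?size_enum_ord //.
by rewrite !nth_ord_enum.
Qed.

(** Out of range [set_at] returns the default [[::]], so the empty list has to be covered besides
    the genuine sets. *)
Lemma set_at_ind (P : seq nat -> Prop) i k :
  P [::] -> (forall i k, P [seq val p | p <- enum (disapp (i : 'I_n) (k : 'I_l))]) ->
  P (set_at sets i k).
Proof.
move=> P0 P1; case: (ltnP i n) => hi; last first.
  by rewrite /set_at [nth _ sets i]nth_default ?size_sets // nth_nil.
case: (ltnP k l) => hk; first by rewrite -[i]/(val (Ordinal hi)) -[k]/(val (Ordinal hk)) set_atE.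
rewrite /set_at [nth [::] _ k]nth_default // (nth_map (Ordinal hi)) ?size_enum_ord //.
by rewrite size_map size_enum_ord.
Qed.

Lemma set_at_lt i k p : p \in set_at sets i k -> p < m.
Proof.
move: p; apply: (set_at_ind (P := fun L => forall p, p \in L -> p < m)) => // i' k' p.
by case/mapP=> q _ ->; apply: ltn_ord.
Qed.

Lemma uniq_set_at i k : uniq (set_at sets i k).
Proof.
apply: (set_at_ind (P := uniq)) => // i' k'.
rewrite map_inj_uniq ?enum_uniq //; exact: val_inj.
Qed.

Lemma encodeE : encode I A = [:: size sets; m; l] ++
    flatten [seq flatten [seq size L :: L | L <- Ls] | Ls <- sets] ++
    size A :: flatten [seq [:: c.1; c.2] | c <- A].
Proof.
rewrite /encode size_sets /sets; congr (_ ++ (flatten _ ++ _)).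
rewrite -map_comp; apply: eq_map => i /=; rewrite -map_comp; congr flatten.
by apply: eq_map => k /=; rewrite size_map -cardE.
Qed.

(** Exchange of summation: agent [i] contributes [l.+1 ^ i] once for each step before [t] whose
    project it disapproves. *)
Lemma sum_weight (o : nat -> nat) (o' : outcome I) t :
  (forall k : 'I_l, val (o' k) = o k) -> t <= l ->
  \sum_(j < t) code_weight l sets j (o j) =
  \sum_(i < n) l.+1 ^ i * disagree o' i t.
Proof.
move=> ho ht; rewrite /code_weight size_sets exchange_big /=.
apply: eq_bigr => i _; rewrite -big_distrr /=; congr (_ * _).
rewrite (big_ord_widen l (fun j => count_mem (o j) (set_at sets i j)) ht).
rewrite /disagree -sum1_card big_mkcond /= [RHS]big_mkcond /=.
apply: eq_bigr => k _; rewrite inE; case: (k < t) => //=.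
rewrite set_atE -ho count_uniq_mem ?map_inj_uniq ?enum_uniq //; last exact: val_inj.
by rewrite (mem_map val_inj) mem_enum; case: (_ \in _).
Qed.

Lemma disagree_lt (o : outcome I) i t : disagree o i t < l.+1.
Proof. by rewrite ltnS -[leqRHS]card_ord; apply: max_card. Qed.

Lemma max_digit_disagree (o : outcome I) t :
  max_digit l.+1 n (\sum_(i < n) l.+1 ^ i * disagree o i t) = \max_(i < n) disagree o i t.
Proof.
pose d j := if insub j is Some i then @disagree I o i t else 0.
have dE (i : 'I_n) : d i = disagree o i t by rewrite /d valK.
rewrite -(eq_bigr _ (fun i _ => congr1 _ (dE i))) -[RHS](eq_bigr _ (fun i _ => dE i)).
by have [i hi|-> _] := @max_digit_code l.+1 n d; rewrite // /d insubT disagree_lt.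
Qed.

Lemma minmax_reach :
  valid_constraints I A ->
  has (fun c => reach m (l.+1 ^ size sets) (code_weight l sets) (violates l sets A) l c
                && ~~ violates l sets A l c) (iota 0 (l.+1 ^ size sets)) <-> minmax_yes I A.
Proof.
case/andP=> /andP[/allP hA _] _.
have B0 : 0 < l.+1 ^ size sets by rewrite expn_gt0.
have stay k c p (hk : k < l) (_ : c < l.+1 ^ size sets) (_ : p < m)
  (hr : reach m (l.+1 ^ size sets) (code_weight l sets) (violates l sets A) k c) :
  c + code_weight l sets k p < l.+1 ^ size sets by exact: (reach_stay uniq_set_at _ hk hr).
have bridge (o : nat -> nat) (o' : outcome I) t : (forall k : 'I_l, val (o' k) = o k) -> t <= l ->
  violates l sets A t (\sum_(j < t) code_weight l sets j (o j)) =
  has (fun tl => (tl.1 == t) && (tl.2 < \max_(i < n) disagree o' i t)) A.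
  by move=> ho ht; rewrite (sum_weight ho ht) /violates size_sets max_digit_disagree.
split.
  case/hasP=> c _ /andP[/(reachP B0 stay _ (leqnn l))[o [o1 -> o3]] o4].
  pose o' : outcome I := fun k => Ordinal (o1 k (ltn_ord k)).
  have ho (k : 'I_l) : val (o' k) = o k by [].
  exists o' => tl htl; have /andP[/andP[_ ht] _] := hA _ htl.
  have : ~~ violates l sets A tl.1 (\sum_(j < tl.1) code_weight l sets j (o j)).
    (* Time [l] is covered by the final test [o4], earlier times by reachability. *)
    move: ht; rewrite leq_eqVlt => /orP[/eqP->|] //; exact: o3.
  rewrite (bridge _ _ _ ho ht) => /hasPn/(_ _ htl).
  by rewrite eqxx -leqNgt.
case=> o' hok.
(* The default 0 concerns only steps from [l] on, outside all sums below. *)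
pose o j := if insub j is Some k then val (o' k) else 0.
have ho (k : 'I_l) : val (o' k) = o k by rewrite /o valK.
have nv t : t <= l -> ~~ violates l sets A t (\sum_(j < t) code_weight l sets j (o j)).
  move=> ht; rewrite (bridge _ _ _ ho ht); apply/hasPn => tl htl.
  by case: eqP => //= <-; rewrite -leqNgt hok.
have hr : reach m (l.+1 ^ size sets) (code_weight l sets) (violates l sets A) l
   (\sum_(j < l) code_weight l sets j (o j)).
  apply/(reachP B0 stay _ (leqnn l)); exists o; split=> // [j hj|t ht]; last exact/nv/ltnW.
  by rewrite -[j]/(val (Ordinal hj)) -ho; apply: ltn_ord.
apply/hasP; exists (\sum_(j < l) code_weight l sets j (o j)); last by rewrite hr nv.
by rewrite mem_iota /= (reach_lt B0 stay (leqnn l) hr).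
Qed.

End Encoding.

(** * The RAM program and its running time *)

Definition solver_prog : program := prelude ++ compile (size prelude) solver.

Lemma code_at_catP p1 p2 : code_at (p1 ++ p2) 0 p1 /\ code_at (p1 ++ p2) (size p1) p2.
Proof.
by split=> j hj; rewrite nth_cat ?hj // ifN ?addKn // -leqNgt leq_addr.
Qed.

Lemma step_end p (f : nat -> nat) : step p (RamState (size p) f) = None.
Proof. by rewrite /step nth_default. Qed.

Lemma exec_halt p t s : step p s = None -> exec p t s = s.
Proof. by case: t => //= t ->. Qed.

Lemma input_size_ge x : size x <= input_size x.
Proof. by elim: x => //= y x IH; rewrite /input_size /= addSn ltnS; apply: leq_trans IH (leq_addl _ _). Qed.

Lemma mem_input_size x y : y \in x -> y < input_size x.
Proof.
elim: x => //= z x IH; rewrite inE /input_size /= => /orP[/eqP->|/IH h]; first exact: leq_addr.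
exact: leq_trans h (leq_addl _ _).
Qed.

Theorem theorem4 : minmax_dec_in_XP_n.
Proof.
(* The factor 16 makes the bound computable by one addition, register 0 holding the input length 1,
   and four doublings; it leaves ample room in the exponent. *)
exists solver_prog, (fun k => 16 * k.+1); split.
  exists [:: IAdd 0 0 1; IAdd 0 0 0; IAdd 0 0 0; IAdd 0 0 0; IAdd 0 0 0] => k.
  by exists 5; split=> //=; lia.
move=> I A vA x.
set n := n_agents I; set S := input_size x; set Y := S ^ n.+1.
have x4 : 3 < size x by rewrite /x encodeE !size_cat /=; lia.
have S4 : 4 <= S by apply: leq_trans (input_size_ge x).
have SY : S <= Y by rewrite -{1}[S]expn1 leq_pexp2l //; lia.
have mx y : y \in x -> y < S by apply: mem_input_size.
have nS : n < S by apply: mx; rewrite !inE eqxx.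
have mS : m_projects I < S by apply: mx; rewrite !inE eqxx ?orbT.
have lS : l_steps I < S by apply: mx; rewrite !inE eqxx ?orbT.
have AS : size A < S by apply: mx; rewrite /x /encode !mem_cat mem_head !orbT.
have BY : (l_steps I).+1 ^ n <= Y.
  rewrite /Y expnS; apply: (@leq_trans (S ^ n)); last by rewrite leq_pmull; lia.
  by case: (n) => // n'; rewrite leq_exp2r.
have [h0 h1] := code_at_catP prelude (compile (size prelude) solver).
have [t [m1 [rg [lt1 e1 r1]]]] := prelude_correct x4 h0.
set s0 := State rg (init_arr x) in r1.
have [|m2 e2 r2] := comp_correct _ wf_solver h1 r1; first by lia.
have [||||||||||R C] := @solver_spec (l_steps I) (m_projects I) (sets I) A
  (@set_at_lt I) (@uniq_set_at I) Y s0.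
- by rewrite -encodeE.
- apply/allP => L /mapP[i _ ->]; by rewrite size_map size_enum_ord.
- apply/allP => L /mapP[i _ ->]; apply/allP => L' /mapP[k _ ->].
  rewrite size_map -cardE; apply: leq_trans (max_card _) _; rewrite card_ord; lia.
- case/andP: vA => /andP[/allP hA _] _; apply/allP => c /hA /andP[/andP[_ h] _]; lia.
- lia.
- lia.
- by rewrite size_sets.
- lia.
- by rewrite size_sets -/n; lia.
- lia.
move: (cost solver s0) (run solver s0) e2 r2 R C => cs s1 e2 r2 R C.
set T := 16 * n.+1 * S ^ (16 * n.+1).
have costT : t + cs <= T.
  clear e2 r2 R.
  have Y3 : S <= Y ^ 3 by apply: leq_trans SY _; rewrite -{1}[Y]expn1 leq_pexp2l //; lia.
  have Sx : size x <= S by apply: input_size_ge.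
  (* The total is at most [64 * S + 590 * Y ^ 3]. Since [4 <= S], the constant [4 ^ 5] is absorbed
     into [S ^ 5], and the exponent [5 + 3 * n.+1] is at most [16 * n.+1]. *)
  apply: (@leq_trans (4 ^ 5 * Y ^ 3)); first by rewrite -[4 ^ 5]/1024; lia.
  apply: (@leq_trans (S ^ (16 * n.+1))); last by rewrite leq_pmull.
  apply: (@leq_trans (S ^ 5 * Y ^ 3)); first by rewrite leq_mul2r leq_exp2r // S4 orbT.
  by rewrite /Y -expnM -expnD leq_pexp2l //; lia.
have e : exec solver_prog T (init_state x) = RamState (size solver_prog) m2.
  (* A halted machine keeps its state, so the exact running time may be padded to [T]. *)
  rewrite -(subnKC costT) exec_add exec_add e1 [size solver_prog]size_cat.
  rewrite [exec _ cs _]e2 -size_cat exec_halt //; exact: step_end.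
exists (regs s1 0); split; last split.
- split; rewrite e; last exact: (rep_reg r2).
  exact: step_end.
- by rewrite R; case: (has _ _).
- by rewrite -(minmax_reach vA) R; case: (has _ _).
Qed.
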